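(* Let $\mathsf{C}$ be a strict braided monoidal category. The categories $\mathsf{cocBT^{f}}$ (finite cocommutative brace triples in $\mathsf{C}$), $\mathsf{cocHBr^{f}}$ (finite cocommutative Hopf braces in $\mathsf{C}$) and $\mathsf{cocPost}\text{-}\mathsf{Hopf}^{\star}$ (cocommutative post-Hopf algebras in $\mathsf{C}$ satisfying condition $(\star)$ of the context) are isomorphic.
   Context: $\mathsf{C}$ is a strict braided monoidal category with tensor product $\otimes$, unit object $K$ and braiding $c$ (not assumed symmetric). For an object $P$ and a morphism $f$, $P\otimes f$ means $id_P\otimes f$ and $f\otimes P$ means $f\otimes id_P$. Algebras, coalgebras, bialgebras and Hopf algebras are internal to $\mathsf{C}$; the tensor product of coalgebras $D,E$ has coproduct $(D\otimes c_{D,E}\otimes E)\circ(\delta_D\otimes\delta_E)$ and counit $\varepsilon_D\otimes\varepsilon_E$, and the tensor product of algebras $A,B$ has product $(\mu_A\otimes\mu_B)\circ(A\otimes c_{B,A}\otimes B)$. A Hopf algebra $H=(H,\eta_H,\mu_H,\varepsilon_H,\delta_H,\lambda_H)$ is a bialgebra with a morphism (antipode) $\lambda_H$ such that $\mu_H\circ(H\otimes\lambda_H)\circ\delta_H=\eta_H\circ\varepsilon_H=\mu_H\circ(\lambda_H\otimes H)\circ\delta_H$; it is cocommutative if $c_{H,H}\circ\delta_H=\delta_H$. Hopf algebra morphisms are morphisms that are both algebra and coalgebra morphisms. An object $P$ is finite if there is an object $P^*$ (its dual) and a $\mathsf{C}$-adjunction $P\otimes-\dashv P^*\otimes-$; the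 unit and counit evaluated at $K$ are morphisms $a_P:K\to P^*\otimes P$ and $b_P:P\otimes P^*\to K$ with $(b_P\otimes P)\circ(P\otimes a_P)=id_P$ and $(P^*\otimes b_P)\circ(a_P\otimes P^* )=id_{P^*}$. Hopf brace: a coalgebra $(H,\varepsilon_H,\delta_H)$ with two Hopf algebra structures $H_1=(H,\eta_H^1,\mu_H^1,\varepsilon_H,\delta_H,\lambda_H^1)$ and $H_2=(H,\eta_H^2,\mu_H^2,\varepsilon_H,\delta_H,\lambda_H^2)$ in $\mathsf{C}$ such that $\mu_H^2\circ(H\otimes\mu_H^1)=\mu_H^1\circ(\mu_H^2\otimes\Gamma_{H_1})\circ(H\otimes c_{H,H}\otimes H)\circ(\delta_H\otimes H\otimes H)$, where $\Gamma_{H_1}=\mu_H^1\circ(\lambda_H^1\otimes\mu_H^2)\circ(\delta_H\otimes H)$. A morphism of Hopf braces is a morphism $f:H\to B$ in $\mathsf{C}$ such that $f:H_1\to B_1$ and $f:H_2\to B_2$ are Hopf algebra morphisms. $\mathsf{cocHBr^{f}}$ is the full subcategory of Hopf braces with $H$ finite and $c_{H,H}\circ\delta_H=\delta_H$. Post-Hopf algebra: a pair $(H,m_H)$ with $H$ a finite Hopf algebra in $\mathsf{C}$ and $m_H:H\otimes H\to H$ a morphism such that (i) $m_H$ is a coalgebra morphism; (ii) $m_H\circ(H\otimes m_H)=m_H\circ((\mu_H\circ(H\otimes m_H)\circ(\delta_H\otimes H))\otimes H)$; (iii) $m_H\circ(H\otimes\mu_H)=\mu_H\circ(m_H\otimes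 m_H)\circ(H\otimes c_{H,H}\otimes H)\circ(\delta_H\otimes H\otimes H)$; (iv) $\alpha_H=(H^*\otimes m_H)\circ(c_{H,H^*}\otimes H)\circ(H\otimes a_H):H\to H^*\otimes H$ is convolution invertible, i.e. there is $\beta_H:H\to H^*\otimes H$ with $(H^*\otimes b_H\otimes H)\circ(\alpha_H\otimes\beta_H)\circ\delta_H=\varepsilon_H\otimes a_H=(H^*\otimes b_H\otimes H)\circ(\beta_H\otimes\alpha_H)\circ\delta_H$. It is cocommutative if $H$ is. A morphism of post-Hopf algebras $(H,m_H)\to(B,m_B)$ is a Hopf algebra morphism $f:H\to B$ with $f\circ m_H=m_B\circ(f\otimes f)$. Put $\widetilde{\beta}_H=(b_H\otimes H)\circ(H\otimes\beta_H):H\otimes H\to H$. Condition $(\star)$ is: $\delta_H\circ\widetilde{\beta}_H=(\widetilde{\beta}_H\otimes\widetilde{\beta}_H)\circ(H\otimes c_{H,H}\otimes H)\circ(\delta_H\otimes\delta_H)$. $\mathsf{cocPost}\text{-}\mathsf{Hopf}^{\star}$ is the full subcategory of post-Hopf algebras that are cocommutative and satisfy $(\star)$. Brace triple: $(H,\gamma_H,T_H)$ with $H=(H,\eta_H,\mu_H,\varepsilon_H,\delta_H,\lambda_H)$ a Hopf algebra in $\mathsf{C}$ with $\lambda_H$ an isomorphism, and morphisms $\gamma_H:H\otimes H\to H$, $T_H:H\to H$ such that (i) $(\gamma_H\otimes H)\circ(H\otimes c_{H,H})\circ(\delta_H\otimes H)=(\gamma_H\otimes H)\circ(H\otimes c_{H,H})\circ((c_{H,H}\circ\delta_H)\otimes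 H)$; (ii) $\gamma_H$ is a coalgebra morphism; (iii) $\gamma_H\circ(H\otimes\mu_H)=\mu_H\circ(\gamma_H\otimes\gamma_H)\circ(H\otimes c_{H,H}\otimes H)\circ(\delta_H\otimes H\otimes H)$; (iv) $\gamma_H\circ(H\otimes\gamma_H)=\gamma_H\circ((\mu_H\circ(H\otimes\gamma_H)\circ(\delta_H\otimes H))\otimes H)$; (v) $\gamma_H\circ(\eta_H\otimes H)=id_H$; (vi) $T_H$ is an isomorphism with (vi.1) $\delta_H\circ T_H=c_{H,H}\circ(T_H\otimes T_H)\circ\delta_H$, (vi.2) $\varepsilon_H\circ T_H=\varepsilon_H$, (vi.3) $\mu_H\circ(H\otimes\gamma_H)\circ((\delta_H\circ T_H)\otimes H)=\mu_H\circ(H\otimes\gamma_H)\circ(((T_H\otimes T_H)\circ\delta_H)\otimes H)$, (vi.4) $\gamma_H\circ(H\otimes T_H)\circ\delta_H=\lambda_H$, (vi.5) $\gamma_H\circ(T_H\otimes H)\circ\delta_H=\lambda_H^{-1}\circ T_H$. A morphism of brace triples $(H,\gamma_H,T_H)\to(B,\gamma_B,T_B)$ is a Hopf algebra morphism $f:H\to B$ with $f\circ\gamma_H=\gamma_B\circ(f\otimes f)$. $\mathsf{cocBT^{f}}$ is the full subcategory of brace triples whose underlying Hopf algebra is finite and cocommutative. *)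

(* Defs.v *)
From Stdlib Require Import ssreflect ProofIrrelevance.

Set Implicit Arguments.
Unset Strict Implicit.
Unset Printing Implicit Defensive.

(** * Categories, functors, isomorphism of categories *)

Record category := Category {
  ob :> Type;
  hom : ob -> ob -> Type;
  idm : forall A, hom A A;
  comp : forall A B D, hom B D -> hom A B -> hom A D;
  comp_idl : forall A B (f : hom A B), comp (idm B) f = f;
  comp_idr : forall A B (f : hom A B), comp f (idm A) = f;
  comp_assoc : forall A B D E (h : hom D E) (g : hom B D) (f : hom A B),
    comp h (comp g f) = comp (comp h g) f
}.

Arguments hom {c} A B.
Arguments idm {c} A.
Arguments comp {c A B D} g f.

Notation "g ∘ f" := (comp g f) (at level 40, left associativity).

Definition inverse_pair (C : category) (A B : C) (f : hom A B) (g : hom B A) :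
  Prop := g ∘ f = idm A /\ f ∘ g = idm B.

Definition is_iso (C : category) (A B : C) (f : hom A B) : Prop :=
  exists g, inverse_pair f g.

Record functor (A B : category) := Functor {
  fob :> A -> B;
  fmap : forall X Y : A, hom X Y -> hom (fob X) (fob Y);
  fmap_id : forall X, fmap (idm X) = idm (fob X);
  fmap_comp : forall X Y Z (g : hom Y Z) (f : hom X Y),
    fmap (g ∘ f) = fmap g ∘ fmap f
}.

Definition functor_id (A : category) : functor A A.
Proof. by exists (fun X => X) (fun X Y f => f). Defined.

Definition functor_comp (A B D : category) (G : functor B D) (F : functor A B) :
  functor A D.
Proof.
exists (fun X => G (F X)) (fun X Y f => fmap G (fmap F f)).
- by move=> X; rewrite !fmap_id.
- by move=> X Y Z g f; rewrite !fmap_comp.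
Defined.

(* Strictly inverse functors: the equalities are between functors (on objects
   and on morphisms), not up to natural isomorphism. *)
Definition isomorphic_categories (A B : category) : Prop :=
  exists (F : functor A B) (G : functor B A),
    functor_comp G F = functor_id A /\ functor_comp F G = functor_id B.

Definition full_subcategory (A : category) (P : A -> Prop) : category.
Proof.
exists {X : A | P X} (fun X Y => hom (proj1_sig X) (proj1_sig Y))
  (fun X => idm (proj1_sig X)) (fun X Y Z g f => g ∘ f).
- by move=> X Y f; apply: comp_idl.
- by move=> X Y f; apply: comp_idr.
- by move=> X Y Z W h g f; apply: comp_assoc.
Defined.

(* Objects of [C] with extra structure [S]; a morphism is a morphism of [C]
   between the underlying objects that satisfies [P]. *)
Definition structured_category (C : category) (S : Type) (U : S -> C)
  (P : forall X Y : S, hom (U X) (U Y) -> Prop)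
  (P_id : forall X, P X X (idm (U X)))
  (P_comp : forall X Y Z (g : hom (U Y) (U Z)) (f : hom (U X) (U Y)),
     P Y Z g -> P X Y f -> P X Z (g ∘ f)) : category.
Proof.
exists S (fun X Y => {f : hom (U X) (U Y) | P X Y f})
  (fun X => exist _ (idm (U X)) (P_id X))
  (fun X Y Z g f => exist _ (proj1_sig g ∘ proj1_sig f)
     (P_comp X Y Z _ _ (proj2_sig g) (proj2_sig f))).
- by move=> X Y [f Pf]; apply: subset_eq_compat; apply: comp_idl.
- by move=> X Y [f Pf]; apply: subset_eq_compat; apply: comp_idr.
- by move=> X Y Z W h g f; apply: subset_eq_compat; apply: comp_assoc.
Defined.

(** * Strict braided monoidal categories *)

(* The identity of [A], seen as a morphism [A -> B] when [A = B]. *)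
Definition idm_eq (C : category) (A B : C) (e : A = B) : hom A B :=
  match e in _ = X return hom A X with eq_refl => idm A end.

(* Strictness is equality of objects, together with equality of morphisms after
   identification of their (equal but not convertible) endpoints. *)
Record strict_monoidal_category := StrictMonoidalCategory {
  smc_cat :> category;
  unit_ob : smc_cat;
  tens : smc_cat -> smc_cat -> smc_cat;
  tensm : forall A A' B B' : smc_cat,
    hom A A' -> hom B B' -> hom (tens A B) (tens A' B');
  tensm_id : forall A B, tensm (idm A) (idm B) = idm (tens A B);
  tensm_comp : forall A A' A'' B B' B''
    (f' : hom A' A'') (f : hom A A') (g' : hom B' B'') (g : hom B B'),
    tensm (f' ∘ f) (g' ∘ g) = tensm f' g' ∘ tensm f g;
  tensA : forall A B D, tens (tens A B) D = tens A (tens B D);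
  tens1l : forall A, tens unit_ob A = A;
  tens1r : forall A, tens A unit_ob = A;
  tensmA : forall A A' B B' D D' (f : hom A A') (g : hom B B') (h : hom D D'),
    idm_eq (tensA A' B' D') ∘ tensm (tensm f g) h
    = tensm f (tensm g h) ∘ idm_eq (tensA A B D);
  tensm1l : forall A A' (f : hom A A'),
    idm_eq (tens1l A') ∘ tensm (idm unit_ob) f = f ∘ idm_eq (tens1l A);
  tensm1r : forall A A' (f : hom A A'),
    idm_eq (tens1r A') ∘ tensm f (idm unit_ob) = f ∘ idm_eq (tens1r A)
}.

Arguments unit_ob {s}.
Arguments tens {s} A B.
Arguments tensm {s A A' B B'} f g.

Notation "A ⊗ B" := (tens A B) (at level 35, right associativity).
Notation "f ⊠ g" := (tensm f g) (at level 35, right associativity).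
Notation "P ◁ f" := (tensm (idm P) f) (at level 35, right associativity).
Notation "f ▷ P" := (tensm f (idm P)) (at level 34, left associativity).

(* All of the following are identities in the strict category. *)
Section StrictIdentities.
Variable C : strict_monoidal_category.
Implicit Types A B D : C.

Definition asc A B D : hom ((A ⊗ B) ⊗ D) (A ⊗ (B ⊗ D)) := idm_eq (tensA A B D).
Definition ascV A B D : hom (A ⊗ (B ⊗ D)) ((A ⊗ B) ⊗ D) :=
  idm_eq (eq_sym (tensA A B D)).
Definition lun A : hom (unit_ob ⊗ A) A := idm_eq (tens1l A).
Definition lunV A : hom A (unit_ob ⊗ A) := idm_eq (eq_sym (tens1l A)).
Definition run A : hom (A ⊗ unit_ob) A := idm_eq (tens1r A).
Definition runV A : hom A (A ⊗ unit_ob) := idm_eq (eq_sym (tens1r A)).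

End StrictIdentities.

Arguments asc {C A B D}.
Arguments ascV {C A B D}.
Arguments lun {C A}.
Arguments lunV {C A}.
Arguments run {C A}.
Arguments runV {C A}.

Record strict_braided_category := StrictBraidedCategory {
  sbc_cat :> strict_monoidal_category;
  braid : forall A B : sbc_cat, hom (A ⊗ B) (B ⊗ A);
  braid_iso : forall A B, is_iso (braid A B);
  braid_nat : forall A A' B B' (f : hom A A') (g : hom B B'),
    braid A' B' ∘ (f ⊠ g) = (g ⊠ f) ∘ braid A B;
  braid_tensr : forall A B D,
    braid A (B ⊗ D)
    = ascV ∘ (B ◁ braid A D) ∘ asc ∘ (braid A B ▷ D) ∘ ascV;
  braid_tensl : forall A B D,
    braid (A ⊗ B) D
    = asc ∘ (braid A D ▷ B) ∘ ascV ∘ (A ◁ braid B D) ∘ asc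
}.

Arguments braid {s} A B.

(* The morphism [A ⊗ c_{B,D} ⊗ E]. *)
Definition mid_braid (C : strict_braided_category) (A B D E : C) :
  hom ((A ⊗ B) ⊗ (D ⊗ E)) ((A ⊗ D) ⊗ (B ⊗ E)) :=
  ascV ∘ (A ◁ (asc ∘ (braid B D ▷ E) ∘ ascV)) ∘ asc.

Arguments mid_braid {C A B D E}.

(** * Finite objects *)

(* A C-adjunction [P ⊗ - ⊣ P* ⊗ -]: an adjunction whose unit and counit are
   compatible with the action of the category on itself by tensoring on the
   right. *)
Record dual (C : strict_monoidal_category) (P : C) := Dual {
  dual_ob : C;
  adj_unit : forall X : C, hom X (dual_ob ⊗ (P ⊗ X));
  adj_counit : forall X : C, hom (P ⊗ (dual_ob ⊗ X)) X;
  adj_unit_nat : forall X Y (f : hom X Y),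
    adj_unit Y ∘ f = (dual_ob ◁ (P ◁ f)) ∘ adj_unit X;
  adj_counit_nat : forall X Y (f : hom X Y),
    adj_counit Y ∘ (P ◁ (dual_ob ◁ f)) = f ∘ adj_counit X;
  adj_triangle_l : forall X,
    adj_counit (P ⊗ X) ∘ (P ◁ adj_unit X) = idm (P ⊗ X);
  adj_triangle_r : forall X,
    (dual_ob ◁ adj_counit X) ∘ adj_unit (dual_ob ⊗ X) = idm (dual_ob ⊗ X);
  adj_unit_tens : forall X Y,
    adj_unit (X ⊗ Y) = (dual_ob ◁ asc) ∘ asc ∘ (adj_unit X ▷ Y);
  adj_counit_tens : forall X Y,
    adj_counit (X ⊗ Y) = (adj_counit X ▷ Y) ∘ ascV ∘ (P ◁ ascV)
}.

Definition finite_ob (C : strict_monoidal_category) (P : C) : Prop :=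
  inhabited (dual P).

Section Duality.
Variables (C : strict_monoidal_category) (P : C) (D : dual P).
Local Notation "P*" := (dual_ob D).

Definition coev : hom unit_ob (P* ⊗ P) := (P* ◁ run) ∘ adj_unit D unit_ob.

Definition ev : hom (P ⊗ P*) unit_ob := adj_counit D unit_ob ∘ (P ◁ runV).

End Duality.

(** * Algebras, coalgebras and Hopf algebras *)

Section RawStructures.
Variable C : strict_braided_category.
Implicit Types A B : C.

Definition is_algebra A (eta : hom unit_ob A) (mu : hom (A ⊗ A) A) : Prop :=
  mu ∘ (eta ▷ A) ∘ lunV = idm A /\
  mu ∘ (A ◁ eta) ∘ runV = idm A /\
  mu ∘ (A ◁ mu) ∘ asc = mu ∘ (mu ▷ A).

Definition is_coalgebra A (eps : hom A unit_ob) (delta : hom A (A ⊗ A)) :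
  Prop :=
  lun ∘ (eps ▷ A) ∘ delta = idm A /\
  run ∘ (A ◁ eps) ∘ delta = idm A /\
  (A ◁ delta) ∘ delta = asc ∘ (delta ▷ A) ∘ delta.

Definition is_algebra_morphism A B
  (etaA : hom unit_ob A) (muA : hom (A ⊗ A) A)
  (etaB : hom unit_ob B) (muB : hom (B ⊗ B) B) (f : hom A B) : Prop :=
  f ∘ etaA = etaB /\ f ∘ muA = muB ∘ (f ⊠ f).

Definition is_coalgebra_morphism A B
  (epsA : hom A unit_ob) (deltaA : hom A (A ⊗ A))
  (epsB : hom B unit_ob) (deltaB : hom B (B ⊗ B)) (f : hom A B) : Prop :=
  epsB ∘ f = epsA /\ deltaB ∘ f = (f ⊠ f) ∘ deltaA.

Definition tens_unit A B (etaA : hom unit_ob A) (etaB : hom unit_ob B) :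
  hom unit_ob (A ⊗ B) := (etaA ⊠ etaB) ∘ lunV.

Definition tens_prod A B (muA : hom (A ⊗ A) A) (muB : hom (B ⊗ B) B) :
  hom ((A ⊗ B) ⊗ (A ⊗ B)) (A ⊗ B) := (muA ⊠ muB) ∘ mid_braid.

Definition tens_counit A B (epsA : hom A unit_ob) (epsB : hom B unit_ob) :
  hom (A ⊗ B) unit_ob := lun ∘ (epsA ⊠ epsB).

Definition tens_coprod A B (deltaA : hom A (A ⊗ A)) (deltaB : hom B (B ⊗ B)) :
  hom (A ⊗ B) ((A ⊗ B) ⊗ (A ⊗ B)) := mid_braid ∘ (deltaA ⊠ deltaB).

(* The unit object is an algebra with unit [idm] and product [lun]. *)
Definition is_bialgebra A (eta : hom unit_ob A) (mu : hom (A ⊗ A) A)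
  (eps : hom A unit_ob) (delta : hom A (A ⊗ A)) : Prop :=
  is_algebra eta mu /\
  is_coalgebra eps delta /\
  is_algebra_morphism eta mu (idm unit_ob) lun eps /\
  is_algebra_morphism eta mu (tens_unit eta eta) (tens_prod mu mu) delta.

Definition is_antipode A (eta : hom unit_ob A) (mu : hom (A ⊗ A) A)
  (eps : hom A unit_ob) (delta : hom A (A ⊗ A)) (lambda : hom A A) : Prop :=
  mu ∘ (A ◁ lambda) ∘ delta = eta ∘ eps /\
  mu ∘ (lambda ▷ A) ∘ delta = eta ∘ eps.

End RawStructures.

Section HopfAlgebras.
Variable C : strict_braided_category.

Record coalgebra := Coalgebra {
  coalg_ob :> C;
  counit : hom coalg_ob unit_ob;
  coprod : hom coalg_ob (coalg_ob ⊗ coalg_ob);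
  coalgebraP : is_coalgebra counit coprod
}.

Definition cocommutative (H : coalgebra) : Prop :=
  braid H H ∘ coprod H = coprod H.

(* Morphisms of coalgebras [H ⊗ H -> H]. *)
Definition is_coalgebra_morphism2 (H : coalgebra) (m : hom (H ⊗ H) H) : Prop :=
  is_coalgebra_morphism
    (tens_counit (counit H) (counit H)) (tens_coprod (coprod H) (coprod H))
    (counit H) (coprod H) m.

Record hopf_structure (H : coalgebra) := HopfStructure {
  eta : hom unit_ob H;
  mu : hom (H ⊗ H) H;
  antipode : hom H H;
  bialgebraP : is_bialgebra eta mu (counit H) (coprod H);
  antipodeP : is_antipode eta mu (counit H) (coprod H) antipode
}.

Definition is_hopf_morphism (H B : coalgebra)
  (SH : hopf_structure H) (SB : hopf_structure B) (f : hom H B) : Prop :=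
  is_algebra_morphism (eta SH) (mu SH) (eta SB) (mu SB) f /\
  is_coalgebra_morphism (counit H) (coprod H) (counit B) (coprod B) f.

Record hopf_algebra := HopfAlgebra {
  hopf_coalg :> coalgebra;
  hopf_str : hopf_structure hopf_coalg
}.

Lemma is_hopf_morphism_id (H : coalgebra) (SH : hopf_structure H) :
  is_hopf_morphism SH SH (idm H).
Proof. by do 2!split; rewrite ?tensm_id ?comp_idl ?comp_idr. Qed.

Lemma is_hopf_morphism_comp (H B D : coalgebra) (SH : hopf_structure H)
  (SB : hopf_structure B) (SD : hopf_structure D) (g : hom B D) (f : hom H B) :
  is_hopf_morphism SB SD g -> is_hopf_morphism SH SB f ->
  is_hopf_morphism SH SD (g ∘ f).
Proof.
move=> [[g1 g2] [g3 g4]] [[f1 f2] [f3 f4]].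
split; split.
- by rewrite -comp_assoc f1.
- by rewrite -comp_assoc f2 comp_assoc g2 tensm_comp -!comp_assoc.
- by rewrite comp_assoc g3.
- by rewrite comp_assoc g4 -comp_assoc f4 tensm_comp -!comp_assoc.
Qed.

End HopfAlgebras.

Arguments counit {C} H : rename.
Arguments coprod {C} H : rename.
Arguments eta {C H} S : rename.
Arguments mu {C H} S : rename.
Arguments antipode {C H} S : rename.

(** * Hopf braces *)

Section HopfBraces.
Variable C : strict_braided_category.

Definition brace_action (H : coalgebra C) (H1 H2 : hopf_structure H) :
  hom (H ⊗ H) H :=
  mu H1 ∘ (antipode H1 ⊠ mu H2) ∘ asc ∘ (coprod H ▷ H).

Record hopf_brace := HopfBrace {
  hbr_coalg :> coalgebra C;
  hbr1 : hopf_structure hbr_coalg;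
  hbr2 : hopf_structure hbr_coalg;
  hbr_compat :
    mu hbr2 ∘ (hbr_coalg ◁ mu hbr1)
    = mu hbr1 ∘ (mu hbr2 ⊠ brace_action hbr1 hbr2) ∘ mid_braid
        ∘ (coprod hbr_coalg ▷ (hbr_coalg ⊗ hbr_coalg))
}.

Definition is_hopf_brace_morphism (H B : hopf_brace) (f : hom H B) : Prop :=
  is_hopf_morphism (hbr1 H) (hbr1 B) f /\ is_hopf_morphism (hbr2 H) (hbr2 B) f.

Definition HBr : category.
Proof.
apply: (@structured_category C hopf_brace (fun H => H) is_hopf_brace_morphism).
- by move=> H; split; apply: is_hopf_morphism_id.
- by move=> H B D g f [g1 g2] [f1 f2]; split;
    [apply: is_hopf_morphism_comp g1 f1|apply: is_hopf_morphism_comp g2 f2].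
Defined.

Definition cocHBr_f : category :=
  @full_subcategory HBr (fun H : hopf_brace => finite_ob H /\ cocommutative H).

End HopfBraces.

(** * Post-Hopf algebras *)

Section PostHopf.
Variable C : strict_braided_category.

(* [mu ∘ (H ⊗ m) ∘ (delta ⊗ H)] *)
Definition sub_adjacent_prod (H : hopf_algebra C) (m : hom (H ⊗ H) H) :
  hom (H ⊗ H) H :=
  mu (hopf_str H) ∘ (H ◁ m) ∘ asc ∘ (coprod H ▷ H).

Definition acts_on_prod (H : hopf_algebra C) (m : hom (H ⊗ H) H) : Prop :=
  m ∘ (H ◁ mu (hopf_str H))
  = mu (hopf_str H) ∘ (m ⊠ m) ∘ mid_braid ∘ (coprod H ▷ (H ⊗ H)).

Definition weak_action (H : hopf_algebra C) (m : hom (H ⊗ H) H) : Prop :=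
  m ∘ (H ◁ m) = m ∘ (sub_adjacent_prod m ▷ H) ∘ ascV.

Section Convolution.
Variables (H : coalgebra C) (D : dual H).
Local Notation "H*" := (dual_ob D).

Definition alpha (m : hom (H ⊗ H) H) : hom H (H* ⊗ H) :=
  (H* ◁ m) ∘ asc ∘ (braid H H* ▷ H) ∘ ascV ∘ (H ◁ coev D) ∘ runV.

(* [H* ⊗ b_H ⊗ H], the product of the algebra [H* ⊗ H] *)
Definition end_prod : hom ((H* ⊗ H) ⊗ (H* ⊗ H)) (H* ⊗ H) :=
  (H* ◁ (lun ∘ (ev D ▷ H) ∘ ascV)) ∘ asc.

Definition is_convolution_inverse (a b : hom H (H* ⊗ H)) : Prop :=
  end_prod ∘ (a ⊠ b) ∘ coprod H = lun ∘ (counit H ⊠ coev D) ∘ runV /\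
  end_prod ∘ (b ⊠ a) ∘ coprod H = lun ∘ (counit H ⊠ coev D) ∘ runV.

Definition beta_tilde (b : hom H (H* ⊗ H)) : hom (H ⊗ H) H :=
  lun ∘ (ev D ▷ H) ∘ ascV ∘ (H ◁ b).

End Convolution.

(* Duals are unique up to isomorphism and convolution inverses are unique, so
   neither [posthopf_inv] nor [posthopf_star] below depends on the choice of a
   dual: quantifying over all of them is the same as fixing one. *)
Record post_hopf_algebra := PostHopfAlgebra {
  posthopf_alg :> hopf_algebra C;
  posthopf_m : hom (posthopf_alg ⊗ posthopf_alg) posthopf_alg;
  posthopf_finite : finite_ob posthopf_alg;
  posthopf_coalg : is_coalgebra_morphism2 posthopf_m;
  posthopf_act : weak_action posthopf_m;
  posthopf_prod : acts_on_prod posthopf_m;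
  posthopf_inv : forall D : dual posthopf_alg,
    exists b, is_convolution_inverse (alpha D posthopf_m) b
}.

Definition is_post_hopf_morphism (H B : post_hopf_algebra) (f : hom H B) :
  Prop :=
  is_hopf_morphism (hopf_str H) (hopf_str B) f /\
  f ∘ posthopf_m H = posthopf_m B ∘ (f ⊠ f).

Definition posthopf_star (H : post_hopf_algebra) : Prop :=
  forall (D : dual H) (b : hom H (dual_ob D ⊗ H)),
    is_convolution_inverse (alpha D (posthopf_m H)) b ->
    coprod H ∘ beta_tilde b
    = (beta_tilde b ⊠ beta_tilde b) ∘ mid_braid ∘ (coprod H ⊠ coprod H).

Definition PostHopf : category.
Proof.
apply: (@structured_category C post_hopf_algebra (fun H => H)
          is_post_hopf_morphism).
- move=> H; split; first exact: is_hopf_morphism_id.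
  by rewrite tensm_id comp_idl comp_idr.
- move=> H B D g f [g1 g2] [f1 f2].
  split; first exact: is_hopf_morphism_comp g1 f1.
  by rewrite -comp_assoc f2 comp_assoc g2 tensm_comp -!comp_assoc.
Defined.

Definition cocPostHopf_star : category :=
  @full_subcategory PostHopf
    (fun H : post_hopf_algebra => cocommutative H /\ posthopf_star H).

End PostHopf.

(** * Brace triples *)

Section BraceTriples.
Variable C : strict_braided_category.

Record brace_triple := BraceTriple {
  bt_alg :> hopf_algebra C;
  bt_gamma : hom (bt_alg ⊗ bt_alg) bt_alg;
  bt_T : hom bt_alg bt_alg;
  bt_antipode_iso : is_iso (antipode (hopf_str bt_alg));
  bt_cocomm_class :
    (bt_gamma ▷ bt_alg) ∘ ascV ∘ (bt_alg ◁ braid bt_alg bt_alg) ∘ asc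
      ∘ (coprod bt_alg ▷ bt_alg)
    = (bt_gamma ▷ bt_alg) ∘ ascV ∘ (bt_alg ◁ braid bt_alg bt_alg) ∘ asc
      ∘ ((braid bt_alg bt_alg ∘ coprod bt_alg) ▷ bt_alg);
  bt_coalg : is_coalgebra_morphism2 bt_gamma;
  bt_prod : acts_on_prod bt_gamma;
  bt_act : weak_action bt_gamma;
  bt_unit : bt_gamma ∘ (eta (hopf_str bt_alg) ▷ bt_alg) ∘ lunV = idm bt_alg;
  bt_T_iso : is_iso bt_T;
  bt_T_coprod :
    coprod bt_alg ∘ bt_T = braid bt_alg bt_alg ∘ (bt_T ⊠ bt_T) ∘ coprod bt_alg;
  bt_T_counit : counit bt_alg ∘ bt_T = counit bt_alg;
  bt_T_prod :
    mu (hopf_str bt_alg) ∘ (bt_alg ◁ bt_gamma) ∘ asc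
      ∘ ((coprod bt_alg ∘ bt_T) ▷ bt_alg)
    = mu (hopf_str bt_alg) ∘ (bt_alg ◁ bt_gamma) ∘ asc
      ∘ (((bt_T ⊠ bt_T) ∘ coprod bt_alg) ▷ bt_alg);
  bt_T_right :
    bt_gamma ∘ (bt_alg ◁ bt_T) ∘ coprod bt_alg = antipode (hopf_str bt_alg);
  bt_T_left : forall lambdaV : hom bt_alg bt_alg,
    inverse_pair (antipode (hopf_str bt_alg)) lambdaV ->
    bt_gamma ∘ (bt_T ▷ bt_alg) ∘ coprod bt_alg = lambdaV ∘ bt_T
}.

Definition is_brace_triple_morphism (H B : brace_triple) (f : hom H B) : Prop :=
  is_hopf_morphism (hopf_str H) (hopf_str B) f /\
  f ∘ bt_gamma H = bt_gamma B ∘ (f ⊠ f).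

Definition BT : category.
Proof.
apply: (@structured_category C brace_triple (fun H => H)
          is_brace_triple_morphism).
- move=> H; split; first exact: is_hopf_morphism_id.
  by rewrite tensm_id comp_idl comp_idr.
- move=> H B D g f [g1 g2] [f1 f2].
  split; first exact: is_hopf_morphism_comp g1 f1.
  by rewrite -comp_assoc f2 comp_assoc g2 tensm_comp -!comp_assoc.
Defined.

Definition cocBT_f : category :=
  @full_subcategory BT (fun H : brace_triple => finite_ob H /\ cocommutative H).

End BraceTriples.

(* Main.v *)
From Stdlib Require Import ssreflect ProofIrrelevance FunctionalExtensionality.
From Stdlib Require Import IndefiniteDescription.
Require Import Defs.

(* For a cocommutative coalgebra X, coalgebra morphisms X -> H behave like
   elements: two of them can be paired along the coproduct of X.  If H is a
   cocommutative Hopf algebra, then c_{H,H} is an involution (Schauenburg), so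
   the tensor powers of H are cocommutative coalgebras again, the antipode is a
   coalgebra morphism, and the elements X -> H form a group.  An identity
   between morphisms from a tensor power of H can be checked on its projections,
   hence on elements.  The theorem thus reduces to skew braces: a group with
   a second group law x o y = x (x . y) is the same as an action "." by
   endomorphisms, with x . (y . z) = (x (x . y)) . z, whose operators are
   invertible; the inverse of x for o is the element T x with x . T x = x^-1.
   Condition (iv) of post-Hopf algebras says precisely that the operators are
   invertible, once morphisms H -> H* ⊗ H are transposed to H ⊗ H -> H. *)

Set Implicit Arguments.
Unset Strict Implicit.
Unset Printing Implicit Defensive.

(** The obstacle is that the category is only braided. Cocommutativity of [H] alone does not pass to
    [H ⊗ H], and the projections of [H ⊗ H] can serve as universal elements only when their source
    is cocommutative. Hence the involutivity of the braiding must be established before any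
    calculation with elements, by cancelling products and coproducts at the level of morphisms.

    Condition [posthopf_star] enters because elements are coalgebra morphisms: the inverse operators
    must send elements to elements, which the convolution inverse does not guarantee by itself.

    The isomorphisms are strict, so both round trips must return equal structures. This holds
    although the antipode built from a post-Hopf algebra comes from a choice: a Hopf structure on a
    given coalgebra is determined by its unit and product. Morphisms cause no trouble, since all the
    functors leave the underlying morphism unchanged. *)

Lemma comp_congr (C : category) (A B B' D : C) (g : hom B D) (g' : hom B' D)
  (f : hom A B) (f' : hom A B') (Z : C) (h : hom Z A) :
  g ∘ f = g' ∘ f' -> g ∘ (f ∘ h) = g' ∘ (f' ∘ h).
Proof. by rewrite !comp_assoc => ->. Qed.

Lemma comp_congr1 (C : category) (A B D : C) (g : hom B D)
  (f : hom A B) (k : hom A D) (Z : C) (h : hom Z A) :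
  g ∘ f = k -> g ∘ (f ∘ h) = k ∘ h.
Proof. by rewrite !comp_assoc => ->. Qed.

(** * Coherence *)

Section Casts.
Variable C : strict_monoidal_category.
Implicit Types A B D E : C.

(** Associativity and unit morphisms are identities carried along equalities of objects. Equality
    proofs being irrelevant, parallel casts coincide, so coherence diagrams without braiding are
    settled by the tactic [casts]. *)
Definition is_cast A B (f : hom A B) : Prop := exists e : A = B, f = idm_eq e.

Lemma cast_unique A B (f g : hom A B) : is_cast f -> is_cast g -> f = g.
Proof. by move=> [e ->] [e' ->]; rewrite (proof_irrelevance _ e e'). Qed.

Lemma cast_id A : is_cast (idm A).
Proof. by exists eq_refl. Qed.

Lemma cast_idm_eq A B (e : A = B) : is_cast (idm_eq e).
Proof. by exists e. Qed.

Lemma cast_comp A B D (g : hom B D) (f : hom A B) :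
  is_cast g -> is_cast f -> is_cast (g ∘ f).
Proof.
move=> [e ->] [e' ->]; destruct e; rewrite comp_idl; exact: cast_idm_eq.
Qed.

Lemma cast_tensm A A' B B' (f : hom A A') (g : hom B B') :
  is_cast f -> is_cast g -> is_cast (f ⊠ g).
Proof.
by move=> [e ->] [e' ->]; destruct e, e'; rewrite tensm_id; apply: cast_id.
Qed.

Lemma cast_inverse A B (f : hom A B) (g : hom B A) :
  is_cast f -> is_cast g -> g ∘ f = idm A.
Proof.
by move=> hf hg; apply: cast_unique; [apply: cast_comp|apply: cast_id].
Qed.

Lemma asc_cast A B D : is_cast (@asc C A B D). Proof. exact: cast_idm_eq. Qed.
Lemma ascV_cast A B D : is_cast (@ascV C A B D). Proof. exact: cast_idm_eq. Qed.
Lemma lun_cast A : is_cast (@lun C A). Proof. exact: cast_idm_eq. Qed.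
Lemma lunV_cast A : is_cast (@lunV C A). Proof. exact: cast_idm_eq. Qed.
Lemma run_cast A : is_cast (@run C A). Proof. exact: cast_idm_eq. Qed.
Lemma runV_cast A : is_cast (@runV C A). Proof. exact: cast_idm_eq. Qed.

End Casts.

#[local] Hint Resolve cast_id cast_comp cast_tensm asc_cast ascV_cast lun_cast
  lunV_cast run_cast runV_cast : casts.

Ltac casts := by apply: cast_unique; eauto 20 with casts.

Section Coherence.
Variable C : strict_monoidal_category.
Implicit Types A B D E : C.

Lemma ascK A B D : ascV ∘ asc = idm ((A ⊗ B) ⊗ D).
Proof. casts. Qed.

Lemma ascVK A B D : asc ∘ ascV = idm (A ⊗ (B ⊗ D)).
Proof. casts. Qed.

Lemma lunK A : lunV ∘ lun = idm (unit_ob ⊗ A).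
Proof. casts. Qed.

Lemma lunVK A : lun ∘ lunV = idm A.
Proof. casts. Qed.

Lemma runK A : runV ∘ run = idm (A ⊗ unit_ob).
Proof. casts. Qed.

Lemma runVK A : run ∘ runV = idm A.
Proof. casts. Qed.

Lemma comp_cancel_l A B D (g : hom B D) (g' : hom D B) (f f' : hom A B) :
  g' ∘ g = idm B -> g ∘ f = g ∘ f' -> f = f'.
Proof.
by move=> h e; rewrite -(comp_idl f) -(comp_idl f') -h -!comp_assoc e.
Qed.

Lemma comp_cancel_r A B D (g : hom A B) (g' : hom B A) (f f' : hom B D) :
  g ∘ g' = idm B -> f ∘ g = f' ∘ g -> f = f'.
Proof.
by move=> h e; rewrite -(comp_idr f) -(comp_idr f') -h !comp_assoc e.
Qed.

Lemma asc_nat A A' B B' D D' (f : hom A A') (g : hom B B') (h : hom D D') :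
  asc ∘ ((f ⊠ g) ⊠ h) = (f ⊠ (g ⊠ h)) ∘ asc.
Proof. exact: tensmA. Qed.

Lemma ascV_nat A A' B B' D D' (f : hom A A') (g : hom B B') (h : hom D D') :
  ascV ∘ (f ⊠ (g ⊠ h)) = ((f ⊠ g) ⊠ h) ∘ ascV.
Proof.
apply: (comp_cancel_r (ascVK _ _ _)).
by rewrite -!comp_assoc ascK comp_idr -asc_nat comp_assoc ascK comp_idl.
Qed.

Lemma lun_nat A A' (f : hom A A') : lun ∘ (unit_ob ◁ f) = f ∘ lun.
Proof. exact: tensm1l. Qed.

Lemma run_nat A A' (f : hom A A') : run ∘ (f ▷ unit_ob) = f ∘ run.
Proof. exact: tensm1r. Qed.

Lemma lunV_nat A A' (f : hom A A') : lunV ∘ f = (unit_ob ◁ f) ∘ lunV.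
Proof.
apply: (comp_cancel_r (lunVK _)).
by rewrite -!comp_assoc lunK comp_idr -lun_nat comp_assoc lunK comp_idl.
Qed.

Lemma runV_nat A A' (f : hom A A') : runV ∘ f = (f ▷ unit_ob) ∘ runV.
Proof.
apply: (comp_cancel_r (runVK _)).
by rewrite -!comp_assoc runK comp_idr -run_nat comp_assoc runK comp_idl.
Qed.

Lemma tensm_compl A B D (P : C) (g : hom B D) (f : hom A B) :
  P ◁ (g ∘ f) = (P ◁ g) ∘ (P ◁ f).
Proof. by rewrite -tensm_comp comp_idl. Qed.

Lemma tensm_compr A B D (P : C) (g : hom B D) (f : hom A B) :
  (g ∘ f) ▷ P = (g ▷ P) ∘ (f ▷ P).
Proof. by rewrite -tensm_comp comp_idl. Qed.

Lemma tensm_split A A' B B' (f : hom A A') (g : hom B B') :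
  f ⊠ g = (A' ◁ g) ∘ (f ▷ B).
Proof. by rewrite -tensm_comp comp_idl comp_idr. Qed.

Lemma tensm_split' A A' B B' (f : hom A A') (g : hom B B') :
  f ⊠ g = (f ▷ B') ∘ (A ◁ g).
Proof. by rewrite -tensm_comp comp_idl comp_idr. Qed.

(* Strictness identifies objects only propositionally, so a morphism and its
   right-nested form have different types; [heq] compares them. *)
Definition heq A B A' B' (f : hom A B) (f' : hom A' B') : Prop :=
  exists (e : A = A') (e' : B = B'), idm_eq e' ∘ f = f' ∘ idm_eq e.

Lemma heq_eq A B (f f' : hom A B) : heq f f' -> f = f'.
Proof.
move=> [e [e']]; rewrite (proof_irrelevance _ e eq_refl).
by rewrite (proof_irrelevance _ e' eq_refl) /= comp_idl comp_idr.
Qed.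

Lemma heq_refl A B (f : hom A B) : heq f f.
Proof. by exists eq_refl, eq_refl; rewrite /= comp_idl comp_idr. Qed.

Lemma heq_of_eq A B (f f' : hom A B) : f = f' -> heq f f'.
Proof. by move=> ->; apply: heq_refl. Qed.

Lemma heq_sym A B A' B' (f : hom A B) (f' : hom A' B') : heq f f' -> heq f' f.
Proof.
move=> [e [e' h]]; destruct e, e'.
by move: h; rewrite /= comp_idl comp_idr => ->; apply: heq_refl.
Qed.

Lemma heq_trans A B A' B' A'' B'' (f : hom A B) (f' : hom A' B')
  (f'' : hom A'' B'') : heq f f' -> heq f' f'' -> heq f f''.
Proof.
move=> [e [e' h]]; destruct e, e'.
by move: h; rewrite /= comp_idl comp_idr => ->.
Qed.

Lemma heq_comp A B D A' B' D' (g : hom B D) (f : hom A B) (g' : hom B' D')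
  (f' : hom A' B') : heq g g' -> heq f f' -> heq (g ∘ f) (g' ∘ f').
Proof.
move=> [e [e' h]] [k [k' h']]; destruct e', k, k'.
move: h h'; rewrite (proof_irrelevance _ e eq_refl) /= !comp_idl !comp_idr.
by move=> -> ->; apply: heq_refl.
Qed.

Lemma heq_tensm A A' B B' A1 A1' B1 B1' (f : hom A A') (g : hom B B')
  (f1 : hom A1 A1') (g1 : hom B1 B1') :
  heq f f1 -> heq g g1 -> heq (f ⊠ g) (f1 ⊠ g1).
Proof.
move=> [e [e' h]] [k [k' h']]; destruct e, e', k, k'.
move: h h'; rewrite /= !comp_idl !comp_idr.
by move=> -> ->; apply: heq_refl.
Qed.

Lemma heq_cast_l A B B' A' D' (c : hom B B') (f : hom A B) (g : hom A' D') :
  is_cast c -> heq f g -> heq (c ∘ f) g.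
Proof. by move=> [e ->] h; destruct e; rewrite comp_idl. Qed.

Lemma heq_cast_r A B B' A' D' (c : hom A B) (f : hom B B') (g : hom A' D') :
  is_cast c -> heq f g -> heq (f ∘ c) g.
Proof. by move=> [e ->] h; destruct e; rewrite comp_idr. Qed.

Lemma heq_asc A A' B B' D D' (f : hom A A') (g : hom B B') (h : hom D D') :
  heq ((f ⊠ g) ⊠ h) (f ⊠ (g ⊠ h)).
Proof. by exists (tensA _ _ _), (tensA _ _ _); apply: tensmA. Qed.

Lemma heq_whisker_assoc A B D D' (f : hom D D') :
  heq ((A ⊗ B) ◁ f) (A ◁ (B ◁ f)).
Proof. rewrite -tensm_id; exact: heq_asc. Qed.

Lemma heq_whisker_assoc_r A A' B D (f : hom A A') :
  heq (f ▷ (B ⊗ D)) (f ▷ B ▷ D).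
Proof. rewrite -tensm_id; apply: heq_sym; exact: heq_asc. Qed.

Lemma heq_unit_l A B (f : hom A B) : heq (unit_ob ◁ f) f.
Proof. by exists (tens1l A), (tens1l B); apply: tensm1l. Qed.

Lemma heq_unit_r A B (f : hom A B) : heq (f ▷ unit_ob) f.
Proof. by exists (tens1r A), (tens1r B); apply: tensm1r. Qed.

End Coherence.

(** * The braiding *)

Section Braiding.
Variable C : strict_braided_category.
Implicit Types A B D E : C.

Lemma braid_mono A B D (f g : hom D (A ⊗ B)) :
  braid A B ∘ f = braid A B ∘ g -> f = g.
Proof. by have [b [h _]] := braid_iso A B; apply: comp_cancel_l h. Qed.

(* As an endomorphism of [A], the braiding with the unit object is invertible,
   and idempotent by the hexagon for [unit_ob ⊗ unit_ob = unit_ob]. *)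
Lemma braid_unit_r A : braid A (@unit_ob C) = lunV ∘ run.
Proof.
set c := braid A unit_ob; pose d := lun ∘ c ∘ runV.
have cd : c = lunV ∘ d ∘ run.
  by rewrite /d !comp_assoc lunK comp_idl -comp_assoc runK comp_idr.
have hcd : heq c d.
  by apply/heq_sym/heq_cast_r; auto with casts;
    apply: heq_cast_l; auto with casts; apply: heq_refl.
have dd : d = d ∘ d.
  apply: heq_eq; apply: heq_trans (heq_sym hcd) _.
  apply: (@heq_trans _ _ _ _ _ _ _ _ (braid A (unit_ob ⊗ unit_ob))).
    have := braid_nat (idm A) (@lun C unit_ob); rewrite -/c => h.
    apply: (@heq_trans _ _ _ _ _ _ _ _ (c ∘ (A ◁ lun))).
      by apply/heq_sym/heq_cast_r; auto with casts; apply: heq_refl.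
    by rewrite h; apply: heq_cast_l; auto with casts; apply: heq_refl.
  rewrite braid_tensr -/c; apply: heq_cast_r; first by auto with casts.
  apply: heq_comp.
    apply: heq_cast_r; first by auto with casts.
    apply: heq_cast_l; first by auto with casts.
    exact: heq_trans (heq_unit_l _) hcd.
  exact: heq_trans (heq_unit_r _) hcd.
have [b [bc cb]] := braid_iso A (@unit_ob C).
have d1 : d = idm A.
  apply: (@comp_cancel_l _ _ _ _ d (run ∘ b ∘ lunV));
    last by rewrite -dd comp_idr.
  rewrite /d -!comp_assoc (comp_congr1 _ (lunK _)) comp_idl.
  by rewrite (comp_congr1 _ bc) comp_idl runVK.
by rewrite cd d1 comp_idr.
Qed.

Lemma braid_unit_l A : braid (@unit_ob C) A = runV ∘ lun.
Proof.
set c := braid unit_ob A; pose d := run ∘ c ∘ lunV.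
have cd : c = runV ∘ d ∘ lun.
  by rewrite /d !comp_assoc runK comp_idl -comp_assoc lunK comp_idr.
have hcd : heq c d.
  by apply/heq_sym/heq_cast_r; auto with casts;
    apply: heq_cast_l; auto with casts; apply: heq_refl.
have dd : d = d ∘ d.
  apply: heq_eq; apply: heq_trans (heq_sym hcd) _.
  apply: (@heq_trans _ _ _ _ _ _ _ _ (braid (unit_ob ⊗ unit_ob) A)).
    have := braid_nat (@lun C unit_ob) (idm A); rewrite -/c => h.
    apply: (@heq_trans _ _ _ _ _ _ _ _ (c ∘ (lun ▷ A))).
      by apply/heq_sym/heq_cast_r; auto with casts; apply: heq_refl.
    by rewrite h; apply: heq_cast_l; auto with casts; apply: heq_refl.
  rewrite braid_tensl -/c; apply: heq_cast_r; first by auto with casts.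
  apply: heq_comp.
    apply: heq_cast_r; first by auto with casts.
    apply: heq_cast_l; first by auto with casts.
    exact: heq_trans (heq_unit_r _) hcd.
  exact: heq_trans (heq_unit_l _) hcd.
have [b [bc cb]] := braid_iso (@unit_ob C) A.
have d1 : d = idm A.
  apply: (@comp_cancel_l _ _ _ _ d (lun ∘ b ∘ runV));
    last by rewrite -dd comp_idr.
  rewrite /d -!comp_assoc (comp_congr1 _ (runK _)) comp_idl.
  by rewrite (comp_congr1 _ bc) comp_idl lunVK.
by rewrite cd d1 comp_idr.
Qed.

(* Locked, here and below, because [rewrite comp_assoc] would otherwise see
   through the definition. *)
Definition front A B A' B' (f : hom (A ⊗ B) (A' ⊗ B')) (W : C) :
  hom (A ⊗ (B ⊗ W)) (A' ⊗ (B' ⊗ W)) :=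
  locked (asc ∘ (f ▷ W) ∘ ascV).

(** The inner morphism is a parameter so that the same formula covers the braiding and its inverse,
    which [braid_involutive] compares. *)
Definition mid_of A B D E B' D' (f : hom (B ⊗ D) (D' ⊗ B')) :
  hom ((A ⊗ B) ⊗ (D ⊗ E)) ((A ⊗ D') ⊗ (B' ⊗ E)) :=
  locked (ascV ∘ (A ◁ front f E) ∘ asc).

End Braiding.

Arguments mid_of {C A B D E B' D'} f.

(** * Crossing the two inner strands of four *)

Section Interchange.
Variable C : strict_braided_category.
Implicit Types A B D E : C.

Lemma mid_braidE A B D E : @mid_braid C A B D E = mid_of (braid B D).
Proof. by rewrite /mid_of /front -!lock. Qed.

Lemma frontE A B A' B' (f : hom (A ⊗ B) (A' ⊗ B')) (W : C) :
  front f W = asc ∘ (f ▷ W) ∘ ascV.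
Proof. by rewrite /front -lock. Qed.

Lemma mid_ofE A B D E B' D' (f : hom (B ⊗ D) (D' ⊗ B')) :
  @mid_of C A B D E _ _ f = ascV ∘ (A ◁ front f E) ∘ asc.
Proof. by rewrite /mid_of -lock. Qed.

Lemma front_comp A B A' B' A'' B'' (f : hom (A ⊗ B) (A' ⊗ B'))
  (g : hom (A' ⊗ B') (A'' ⊗ B'')) (W : C) :
  front (g ∘ f) W = front g W ∘ front f W.
Proof.
rewrite !frontE -!comp_assoc (comp_congr1 _ (ascK _ _ _)) comp_idl.
by rewrite tensm_compr -!comp_assoc.
Qed.

Lemma front_id A B (W : C) : front (idm (A ⊗ B)) W = idm _.
Proof. by rewrite frontE tensm_id comp_idr ascVK. Qed.

Lemma front_nat A B A' B' A1 B1 A1' B1' (f : hom (A ⊗ B) (A' ⊗ B'))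
  (f1 : hom (A1 ⊗ B1) (A1' ⊗ B1')) (a : hom A A1) (b : hom B B1)
  (a' : hom A' A1') (b' : hom B' B1') (W W1 : C) (g : hom W W1) :
  f1 ∘ (a ⊠ b) = (a' ⊠ b') ∘ f ->
  front f1 W1 ∘ (a ⊠ (b ⊠ g)) = (a' ⊠ (b' ⊠ g)) ∘ front f W.
Proof.
move=> h; rewrite !frontE -!comp_assoc ascV_nat (comp_assoc (f1 ▷ W1)).
rewrite -tensm_comp h comp_idl -(comp_idr g) tensm_comp comp_idr.
by rewrite -comp_assoc (comp_congr _ (asc_nat _ _ _)).
Qed.

Lemma mid_of_cast A B D E (f : hom (B ⊗ D) (D ⊗ B)) :
  is_cast f -> is_cast (@mid_of C A B D E _ _ f).
Proof. by rewrite mid_ofE frontE => h; eauto 20 with casts. Qed.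

Lemma mid_of_nat A B D E A' B' D' E' (f : hom A A') (g : hom B B')
  (h : hom D D') (k : hom E E') :
  mid_of (braid B' D') ∘ ((f ⊠ g) ⊠ (h ⊠ k))
  = ((f ⊠ h) ⊠ (g ⊠ k)) ∘ mid_of (braid B D).
Proof.
rewrite !mid_ofE -!comp_assoc asc_nat (comp_assoc (A' ◁ _)).
rewrite -tensm_comp (front_nat _ (braid_nat g h)) comp_idl.
rewrite -(comp_idr f) tensm_comp comp_idr -comp_assoc.
by rewrite (comp_congr _ (ascV_nat _ _ _)).
Qed.

Lemma mid_of_nat' A B D E A' B' D' E' (f : hom A A') (g : hom B B')
  (h : hom D D') (k : hom E E') (Z : C) (x : hom Z _) :
  ((f ⊠ h) ⊠ (g ⊠ k)) ∘ (mid_of (braid B D) ∘ x)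
  = mid_of (braid B' D') ∘ (((f ⊠ g) ⊠ (h ⊠ k)) ∘ x).
Proof. by rewrite !comp_assoc mid_of_nat. Qed.

Lemma heq_front_tens A B A' B' (f : hom (A ⊗ B) (A' ⊗ B')) (W : C) :
  heq (f ▷ W) (front f W).
Proof.
rewrite frontE; apply/heq_sym/heq_cast_r; auto with casts.
by apply: heq_cast_l; auto with casts; apply: heq_refl.
Qed.

Lemma heq_front_whisker A B A' B' (f : hom (A ⊗ B) (A' ⊗ B')) (D W : C) :
  heq (front f D ▷ W) (front f (D ⊗ W)).
Proof.
rewrite frontE !tensm_compr.
apply: heq_cast_r; first by auto with casts.
apply: heq_cast_l; first by auto with casts.
apply: heq_trans (heq_front_tens _ _).
by apply: heq_sym; apply: heq_whisker_assoc_r.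
Qed.

Lemma heq_mid_of A B D E B' D' (f : hom (B ⊗ D) (D' ⊗ B')) :
  heq (@mid_of C A B D E _ _ f) (A ◁ front f E).
Proof.
rewrite mid_ofE; apply: heq_cast_r; auto with casts.
by apply: heq_cast_l; auto with casts; apply: heq_refl.
Qed.

Lemma heq_front_braid_tensl A B D (W : C) :
  heq (braid (A ⊗ B) D ▷ W)
      (front (braid A D) (B ⊗ W) ∘ (A ◁ front (braid B D) W)).
Proof.
rewrite braid_tensl !tensm_compr.
apply: heq_cast_r; first by auto with casts.
apply: heq_comp.
  apply: heq_cast_r; first by auto with casts.
  apply: heq_cast_l; first by auto with casts.
  apply: heq_trans (heq_front_tens _ _).
  by apply: heq_sym; apply: heq_whisker_assoc_r.
apply: heq_trans (heq_asc _ _ _) _.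
by apply: heq_tensm (heq_refl _) (heq_front_tens _ _).
Qed.

Lemma heq_braid_tensl A B D :
  heq (braid (A ⊗ B) D) (front (braid A D) B ∘ (A ◁ braid B D)).
Proof.
rewrite braid_tensl.
apply: heq_cast_r; first by auto with casts.
apply: heq_comp; last exact: heq_refl.
apply: heq_cast_r; first by auto with casts.
apply: heq_cast_l; first by auto with casts.
exact: heq_front_tens.
Qed.

Lemma heq_front_braid_tensr A B D (W : C) :
  heq (braid A (B ⊗ D) ▷ W)
      ((B ◁ front (braid A D) W) ∘ front (braid A B) (D ⊗ W)).
Proof.
rewrite braid_tensr !tensm_compr.
apply: heq_cast_r; first by auto with casts.
apply: heq_comp.
  apply: heq_cast_r; first by auto with casts.
  apply: heq_cast_l; first by auto with casts.
  apply: heq_trans (heq_asc _ _ _) _.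
  by apply: heq_tensm (heq_refl _) (heq_front_tens _ _).
apply: heq_trans (heq_front_tens _ _).
by apply: heq_sym; apply: heq_whisker_assoc_r.
Qed.

(** By the hexagons the block braiding consists of four crossings. The first of them takes [B] past
    [D] and is undone by [f]; the outer two factors then cross after [A], [D] and [B], [E] have. *)
Lemma braid_mid_of A B D E (f : hom (D ⊗ B) (B ⊗ D)) :
  braid B D ∘ f = idm _ ->
  braid (A ⊗ B) (D ⊗ E) ∘ @mid_of C A D B E _ _ f
  = mid_of (braid A E) ∘ (braid A D ⊠ braid B E).
Proof.
move=> h; apply: heq_eq.
apply: (@heq_trans _ _ _ _ _ _ _ _
  ((D ◁ front (braid A E) B) ∘ (D ◁ (A ◁ braid B E))
   ∘ (front (braid A D) (B ⊗ E) ∘ (A ◁ front (braid B D) E))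
   ∘ (A ◁ front f E))).
  apply: heq_comp; last exact: heq_mid_of.
  rewrite braid_tensr; apply: heq_cast_r; first by auto with casts.
  apply: heq_comp; last exact: heq_front_braid_tensl.
  apply: heq_cast_r; first by auto with casts.
  apply: heq_cast_l; first by auto with casts.
  rewrite -tensm_compl; apply: heq_tensm (heq_refl _) (heq_braid_tensl _ _ _).
apply: heq_sym.
rewrite -!comp_assoc -tensm_compl -front_comp h front_id tensm_id comp_idr.
apply: heq_comp; first exact: heq_mid_of.
rewrite tensm_split; apply: heq_comp; last exact: heq_front_tens.
exact: heq_whisker_assoc.
Qed.

(** This is the coassociativity of a tensor product of coalgebras. Both sides perform the same three
    crossings; they differ in the order of [A2] past [B1] and [A3] past [B2], which involve disjoint
    strands and commute by [front_nat]. *)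
Lemma mid_of_assoc A1 A2 A3 B1 B2 B3 :
  (idm (A1 ⊗ B1) ⊠ @mid_of C A2 A3 B2 B3 _ _ (braid A3 B2))
    ∘ mid_of (braid (A2 ⊗ A3) B1) ∘ (asc ⊠ asc)
  = asc ∘ (mid_of (braid A2 B1) ▷ (A3 ⊗ B3)) ∘ mid_of (braid A3 (B1 ⊗ B2)).
Proof.
apply: heq_eq.
apply: (@heq_trans _ _ _ _ _ _ _ _
  ((A1 ◁ (B1 ◁ (A2 ◁ front (braid A3 B2) B3)))
   ∘ (A1 ◁ (front (braid A2 B1) (A3 ⊗ (B2 ⊗ B3))
            ∘ (A2 ◁ front (braid A3 B1) (B2 ⊗ B3)))))).
  apply: heq_cast_r; first by auto with casts.
  apply: heq_comp.
    apply: heq_trans (heq_whisker_assoc _ _ _) _.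
    apply: heq_tensm (heq_refl _) _; apply: heq_tensm (heq_refl _) _.
    exact: heq_mid_of.
  apply: heq_trans (heq_mid_of _ _ _) _.
  apply: heq_tensm (heq_refl _) _.
  apply: heq_trans (heq_front_braid_tensl _ _ _ _).
  by apply: heq_sym; apply: heq_front_tens.
apply: heq_sym; rewrite -comp_assoc.
apply: heq_cast_l; first by auto with casts.
apply: (@heq_trans _ _ _ _ _ _ _ _
  ((A1 ◁ front (braid A2 B1) (B2 ⊗ (A3 ⊗ B3)))
   ∘ (A1 ◁ (A2 ◁ ((B1 ◁ front (braid A3 B2) B3)
            ∘ front (braid A3 B1) (B2 ⊗ B3)))))).
  apply: heq_comp.
    rewrite mid_ofE !tensm_compr.
    apply: heq_cast_r; first by auto with casts.
    apply: heq_cast_l; first by auto with casts.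
    apply: heq_trans (heq_asc _ _ _) _.
    apply: heq_tensm (heq_refl _) _.
    exact: heq_front_whisker.
  apply: heq_trans (heq_mid_of _ _ _) _.
  apply: heq_trans (heq_whisker_assoc _ _ _) _.
  apply: heq_tensm (heq_refl _) _; apply: heq_tensm (heq_refl _) _.
  apply: heq_trans (heq_front_braid_tensr _ _ _ _).
  by apply: heq_sym; apply: heq_front_tens.
apply: heq_of_eq; rewrite -!tensm_compl !comp_assoc; congr (_ ◁ _).
rewrite !tensm_compl !comp_assoc; congr (_ ∘ _).
by apply: front_nat; rewrite !tensm_id comp_idl comp_idr.
Qed.

End Interchange.

(** * Points of cocommutative coalgebras *)

Section Pairing.
Variable C : strict_braided_category.
Implicit Types (X Y : coalgebra C) (A B D E : C).

Definition pair X A B (f : hom X A) (g : hom X B) : hom X (A ⊗ B) :=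
  locked ((f ⊠ g) ∘ coprod X).

Definition is_cmor X Y (f : hom X Y) : Prop :=
  is_coalgebra_morphism (counit X) (coprod X) (counit Y) (coprod Y) f.

Lemma pairE X A B (f : hom X A) (g : hom X B) :
  pair f g = (f ⊠ g) ∘ coprod X.
Proof. by rewrite /pair -lock. Qed.

Lemma tensm_pair X A A' B B' (f : hom X A) (g : hom X B) (h : hom A A')
  (k : hom B B') : (h ⊠ k) ∘ pair f g = pair (h ∘ f) (k ∘ g).
Proof. by rewrite !pairE comp_assoc -tensm_comp. Qed.

Lemma pair_comp X Y A B (f : hom Y A) (g : hom Y B) (h : hom X Y) :
  is_cmor h -> pair f g ∘ h = pair (f ∘ h) (g ∘ h).
Proof.
by move=> [_ e]; rewrite !pairE -comp_assoc e comp_assoc -tensm_comp.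
Qed.

Lemma pair_id X : pair (idm X) (idm X) = coprod X.
Proof. by rewrite pairE tensm_id comp_idl. Qed.

Lemma coprod_comp X Y (f : hom X Y) : is_cmor f -> coprod Y ∘ f = pair f f.
Proof. by move=> [_ e]; rewrite e pairE. Qed.

Lemma counit_comp X Y (f : hom X Y) : is_cmor f -> counit Y ∘ f = counit X.
Proof. by case. Qed.

Lemma counit_coprod_l X : (counit X ▷ X) ∘ coprod X = lunV.
Proof.
have [h _] := coalgebraP X; apply: (comp_cancel_l (lunK _)).
by rewrite comp_assoc h lunVK.
Qed.

Lemma counit_coprod_r X : (X ◁ counit X) ∘ coprod X = runV.
Proof.
have [_ [h _]] := coalgebraP X; apply: (comp_cancel_l (runK _)).
by rewrite comp_assoc h runVK.
Qed.

Lemma counit_coprod X : (counit X ⊠ counit X) ∘ coprod X = lunV ∘ counit X.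
Proof. by rewrite tensm_split -comp_assoc counit_coprod_l lunV_nat. Qed.

Lemma coprod_assoc X :
  (X ◁ coprod X) ∘ coprod X = asc ∘ (coprod X ▷ X) ∘ coprod X.
Proof. by have [_ [_ h]] := coalgebraP X. Qed.

Lemma pair_counit_l X A (f : hom X A) : pair (counit X) f = lunV ∘ f.
Proof.
by rewrite pairE tensm_split -comp_assoc counit_coprod_l lunV_nat.
Qed.

Lemma pair_counit_r X A (f : hom X A) : pair f (counit X) = runV ∘ f.
Proof.
by rewrite pairE tensm_split' -comp_assoc counit_coprod_r runV_nat.
Qed.

Lemma asc_pair X A B D (f : hom X A) (g : hom X B) (h : hom X D) :
  asc ∘ pair (pair f g) h = pair f (pair g h).
Proof.
rewrite !pairE -{1}(comp_idr h) -{2}(comp_idr f) !tensm_comp.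
by rewrite -!comp_assoc coprod_assoc !comp_assoc asc_nat.
Qed.

Lemma ascV_pair X A B D (f : hom X A) (g : hom X B) (h : hom X D) :
  ascV ∘ pair f (pair g h) = pair (pair f g) h.
Proof. by rewrite -asc_pair comp_assoc ascK comp_idl. Qed.

Lemma braid_pair X A B (f : hom X A) (g : hom X B) :
  cocommutative X -> braid A B ∘ pair f g = pair g f.
Proof. by move=> h; rewrite !pairE comp_assoc braid_nat -comp_assoc h. Qed.

Lemma mid_of_pair X A B D E (f : hom X A) (g : hom X B) (h : hom X D)
  (k : hom X E) : cocommutative X ->
  mid_of (braid B D) ∘ pair (pair f g) (pair h k) = pair (pair f h) (pair g k).
Proof.
move=> hX; rewrite mid_ofE frontE -!comp_assoc asc_pair.
rewrite tensm_pair -!comp_assoc ascV_pair tensm_pair braid_pair // asc_pair.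
by rewrite ascV_pair !comp_idl.
Qed.

Lemma cmor_id X : is_cmor (idm X).
Proof. by split; rewrite ?tensm_id ?comp_idl ?comp_idr. Qed.

Lemma cmor_comp X Y (Z : coalgebra C) (g : hom Y Z) (f : hom X Y) :
  is_cmor g -> is_cmor f -> is_cmor (g ∘ f).
Proof.
move=> [g1 g2] [f1 f2]; split; first by rewrite comp_assoc g1.
by rewrite comp_assoc g2 -comp_assoc f2 comp_assoc -tensm_comp.
Qed.

End Pairing.

(** * The tensor product of coalgebras as a product on points *)

Section TensorCoalgebra.
Variables (C : strict_braided_category).
Variables (A B : coalgebra C).

Lemma tens_coalgebraP :
  is_coalgebra (locked (tens_counit (counit A) (counit B)))
    (locked (tens_coprod (coprod A) (coprod B))).
Proof.
rewrite -!lock /tens_counit /tens_coprod mid_braidE; split; last split.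
- rewrite tensm_compr -(tensm_id A B) -!comp_assoc.
  rewrite mid_of_nat' -tensm_comp.
  (* After the counits are applied, the only crossing left is with the unit object, and
     [braid_unit_r] makes it a cast. *)
  rewrite !counit_coprod_l; apply: cast_unique; last by auto with casts.
  have := @mid_of_cast C unit_ob A unit_ob B (braid A unit_ob).
  by rewrite braid_unit_r; eauto 20 with casts.
- rewrite tensm_compl -(tensm_id A B) -!comp_assoc.
  rewrite mid_of_nat' -tensm_comp.
  rewrite !counit_coprod_r; apply: cast_unique; last by auto with casts.
  have := @mid_of_cast C A unit_ob B unit_ob (braid unit_ob B).
  by rewrite braid_unit_l; eauto 20 with casts.
- rewrite tensm_compl tensm_compr -!comp_assoc -(tensm_id A B).
  rewrite !mid_of_nat' -!tensm_comp.
  rewrite !coprod_assoc -!comp_assoc !tensm_comp !comp_assoc tensm_id.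
  by rewrite mid_of_assoc.
Qed.

Definition tens_coalg : coalgebra C := Coalgebra tens_coalgebraP.

Definition fstp : hom tens_coalg A := locked (run ∘ (A ◁ counit B)).
Definition sndp : hom tens_coalg B := locked (lun ∘ (counit A ▷ B)).

Lemma tens_coprodE :
  coprod tens_coalg = mid_of (braid A B) ∘ (coprod A ⊠ coprod B).
Proof. by rewrite /= -lock /tens_coprod mid_braidE. Qed.

Lemma tens_counitE : counit tens_coalg = lun ∘ (counit A ⊠ counit B).
Proof. by rewrite /= -lock. Qed.

Lemma fstp_cmor : is_cmor fstp.
Proof.
rewrite /is_cmor /is_coalgebra_morphism tens_coprodE tens_counitE.
rewrite /fstp -lock; split.
  rewrite comp_assoc -run_nat -comp_assoc -tensm_split'.
  by congr (_ ∘ _); casts.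
rewrite comp_assoc -run_nat -comp_assoc -tensm_split' tensm_comp -!comp_assoc.
rewrite mid_of_nat' -tensm_comp tensm_id.
rewrite counit_coprod comp_idl -{2}(comp_idl (coprod A)) tensm_comp.
rewrite 2!comp_assoc; congr (_ ∘ _).
apply: cast_unique; eauto with casts.
have := @mid_of_cast C A A unit_ob unit_ob (braid A unit_ob).
by rewrite braid_unit_r; eauto 20 with casts.
Qed.

Lemma sndp_cmor : is_cmor sndp.
Proof.
rewrite /is_cmor /is_coalgebra_morphism tens_coprodE tens_counitE.
rewrite /sndp -lock; split.
  rewrite comp_assoc -lun_nat -comp_assoc -tensm_split.
  by congr (_ ∘ _); casts.
rewrite comp_assoc -lun_nat -comp_assoc -tensm_split tensm_comp -!comp_assoc.
rewrite mid_of_nat' -tensm_comp tensm_id.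
rewrite counit_coprod comp_idl -{2}(comp_idl (coprod B)) tensm_comp.
rewrite 2!comp_assoc; congr (_ ∘ _).
apply: cast_unique; eauto with casts.
have := @mid_of_cast C unit_ob unit_ob B B (braid unit_ob B).
by rewrite braid_unit_l; eauto 20 with casts.
Qed.

(** The identity of [A ⊗ B] is thus the generic pair of elements: a morphism out of [A ⊗ B] is known
    from its value there. *)
Lemma pair_fstp_sndp : pair fstp sndp = idm (A ⊗ B).
Proof.
rewrite pairE tens_coprodE /fstp /sndp -!lock tensm_comp -!comp_assoc.
rewrite mid_of_nat' -tensm_comp.
rewrite counit_coprod_l counit_coprod_r.
apply: cast_unique; last by auto with casts.
have := @mid_of_cast C A unit_ob unit_ob B (braid unit_ob unit_ob).
rewrite braid_unit_l => h.
have {}h := h (cast_comp (runV_cast _) (lun_cast _)).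
apply: cast_comp; first by auto with casts.
by apply: cast_comp; [exact: h|apply: cast_tensm; auto with casts].
Qed.

Lemma fstp_pair (X : coalgebra C) (f : hom X A) (g : hom X B) :
  is_cmor g -> fstp ∘ pair f g = f.
Proof.
move=> hg; rewrite /fstp -lock -comp_assoc tensm_pair counit_comp //.
by rewrite pair_counit_r comp_idl comp_assoc runVK comp_idl.
Qed.

Lemma sndp_pair (X : coalgebra C) (f : hom X A) (g : hom X B) :
  is_cmor f -> sndp ∘ pair f g = g.
Proof.
move=> hf; rewrite /sndp -lock -comp_assoc tensm_pair counit_comp //.
by rewrite pair_counit_l comp_idl comp_assoc lunVK comp_idl.
Qed.

Lemma tens_cocommutative :
  cocommutative A -> cocommutative B -> braid B A ∘ braid A B = idm _ ->
  cocommutative tens_coalg.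
Proof.
move=> hA hB h; rewrite /cocommutative tens_coprodE comp_assoc.
by rewrite braid_mid_of // -comp_assoc -tensm_comp hA hB.
Qed.

Lemma pair_cmor (X : coalgebra C) (f : hom X A) (g : hom X B) :
  cocommutative X -> is_cmor f -> is_cmor g ->
  @is_cmor _ X tens_coalg (pair f g).
Proof.
move=> hX hf hg; split.
  rewrite tens_counitE -comp_assoc tensm_pair !counit_comp // pair_counit_l.
  by rewrite comp_assoc lunVK comp_idl.
rewrite tens_coprodE -comp_assoc tensm_pair !coprod_comp // mid_of_pair //.
by rewrite pairE.
Qed.

(** It suffices to test on the generic pair, with [X] the tensor coalgebra itself; the hypotheses on
    [A] and [B] make this [X] cocommutative. *)
Lemma point_ext2 (Z : C) (u v : hom (A ⊗ B) Z) :
  cocommutative A -> cocommutative B -> braid B A ∘ braid A B = idm _ ->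
  (forall (X : coalgebra C) (p : hom X A) (q : hom X B), cocommutative X ->
     is_cmor p -> is_cmor q -> u ∘ pair p q = v ∘ pair p q) -> u = v.
Proof.
move=> hA hB h e; rewrite -(comp_idr u) -(comp_idr v) -pair_fstp_sndp.
exact: e (tens_cocommutative hA hB h) fstp_cmor sndp_cmor.
Qed.

End TensorCoalgebra.

(** * The braiding of a cocommutative Hopf algebra *)

Section HopfPoints.
Variable C : strict_braided_category.

Section ConvolutionAction.
Variables (H : coalgebra C) (S : hopf_structure H).
Local Notation η := (eta S).
Local Notation μ := (mu S).
Local Notation λ := (antipode S).
Local Notation δ := (coprod H).

Lemma mu_eta_l : μ ∘ (η ▷ H) = lun.
Proof.
have [[h _] _] := bialgebraP S.
by apply: (comp_cancel_r (lunK _)); rewrite h lunVK.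
Qed.

Lemma mu_eta_r : μ ∘ (H ◁ η) = run.
Proof.
have [[_ [h _]] _] := bialgebraP S.
by apply: (comp_cancel_r (runK _)); rewrite h runVK.
Qed.

Lemma mu_assoc : μ ∘ (H ◁ μ) ∘ asc = μ ∘ (μ ▷ H).
Proof. by have [[_ [_ h]] _] := bialgebraP S. Qed.

Lemma antipode_r : μ ∘ (H ◁ λ) ∘ δ = η ∘ counit H.
Proof. by have [h _] := antipodeP S. Qed.

Lemma antipode_l : μ ∘ (λ ▷ H) ∘ δ = η ∘ counit H.
Proof. by have [_ h] := antipodeP S. Qed.

(* Convolution by the identity is undone by convolution by the antipode. *)
Lemma conv_right_inj (M N : C) (m : hom (M ⊗ H) M) (d : hom N (N ⊗ H))
  (u v : hom N M) :
  m ∘ (m ▷ H) = m ∘ (M ◁ μ) ∘ asc -> m ∘ (M ◁ η) = run ->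
  (d ▷ H) ∘ d = ascV ∘ (N ◁ δ) ∘ d -> (N ◁ counit H) ∘ d = runV ->
  m ∘ (u ▷ H) ∘ d = m ∘ (v ▷ H) ∘ d -> u = v.
Proof.
move=> mA m1 dA d1.
have K w : m ∘ ((m ∘ (w ▷ H) ∘ d) ⊠ λ) ∘ d = w.
  have -> : (m ∘ (w ▷ H) ∘ d) ⊠ λ = (m ▷ H) ∘ ((w ▷ H) ⊠ λ) ∘ (d ▷ H).
    by rewrite -!tensm_comp comp_idl comp_idr.
  rewrite -!comp_assoc dA !comp_assoc mA -(comp_assoc _ asc) asc_nat.
  rewrite -!comp_assoc (comp_congr1 _ (ascVK _ _ _)) comp_idl.
  have e : (M ◁ μ) ∘ ((w ⊠ (H ◁ λ)) ∘ (N ◁ δ))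
    = (M ◁ η) ∘ ((w ▷ unit_ob) ∘ (N ◁ counit H)).
    rewrite -!tensm_comp !comp_idl !comp_idr.
    by rewrite (comp_assoc μ) antipode_r.
  rewrite (comp_assoc _ _ d) (comp_assoc _ _ d) e -!comp_assoc d1.
  by rewrite comp_assoc m1 comp_assoc run_nat -comp_assoc runVK comp_idr.
by move=> e; rewrite -(K u) -(K v) e.
Qed.

Lemma conv_left_inj (M N : C) (m : hom (H ⊗ M) M) (d : hom N (H ⊗ N))
  (u v : hom N M) :
  m ∘ (H ◁ m) = m ∘ (μ ▷ M) ∘ ascV -> m ∘ (η ▷ M) = lun ->
  (H ◁ d) ∘ d = asc ∘ (δ ▷ N) ∘ d -> (counit H ▷ N) ∘ d = lunV ->
  m ∘ (H ◁ u) ∘ d = m ∘ (H ◁ v) ∘ d -> u = v.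
Proof.
move=> mA m1 dA d1.
have K w : m ∘ (λ ⊠ (m ∘ (H ◁ w) ∘ d)) ∘ d = w.
  have -> : λ ⊠ (m ∘ (H ◁ w) ∘ d) = (H ◁ m) ∘ (λ ⊠ (H ◁ w)) ∘ (H ◁ d).
    by rewrite -!tensm_comp comp_idl comp_idr.
  rewrite -!comp_assoc dA !comp_assoc mA -(comp_assoc _ ascV) ascV_nat.
  rewrite -!comp_assoc (comp_congr1 _ (ascK _ _ _)) comp_idl.
  have e : (μ ▷ M) ∘ (((λ ▷ H) ⊠ w) ∘ (δ ▷ N))
    = (η ▷ M) ∘ ((unit_ob ◁ w) ∘ (counit H ▷ N)).
    rewrite -!tensm_comp !comp_idl !comp_idr.
    by rewrite (comp_assoc μ) antipode_l.
  rewrite (comp_assoc _ _ d) (comp_assoc _ _ d) e -!comp_assoc d1.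
  by rewrite comp_assoc m1 comp_assoc lun_nat -comp_assoc lunVK comp_idr.
by move=> e; rewrite -(K u) -(K v) e.
Qed.

(** The expression is [f] convolved with the identity on the left and then on the right. Convolution
    by the antipode removes each of the two layers. *)
Lemma bialgebra_prod_inj (f g : hom (H ⊗ H) (H ⊗ H)) :
  (μ ⊠ μ) ∘ mid_of f ∘ (δ ⊠ δ) = (μ ⊠ μ) ∘ mid_of g ∘ (δ ⊠ δ) -> f = g.
Proof.
(* [mL] and [dL] let [H] act and coact on [H ⊗ H] from the left through the first factor, [mR] and
   [dR] from the right through the second. *)
pose mL := (μ ▷ H) ∘ ascV; pose dL := asc ∘ (δ ▷ H).
pose mR := (H ◁ μ) ∘ asc; pose dR := ascV ∘ (H ◁ δ).
have F (h : hom (H ⊗ H) (H ⊗ H)) :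
  (μ ⊠ μ) ∘ mid_of h ∘ (δ ⊠ δ)
  = mR ∘ ((mL ∘ (H ◁ h) ∘ dL) ▷ H) ∘ dR.
  rewrite /mL /dL !tensm_compr /mR /dR.
  have -> : (μ ⊠ μ) ∘ mid_of h ∘ (δ ⊠ δ)
    = (H ◁ μ) ∘ ((μ ▷ (H ⊗ H)) ∘ (mid_of h ∘ ((δ ▷ (H ⊗ H)) ∘ (H ◁ δ)))).
    by rewrite (tensm_split μ) (tensm_split' δ) -!comp_assoc.
  rewrite -!comp_assoc; congr (_ ∘ _).
  rewrite (comp_congr _ (asc_nat _ _ _)) tensm_id; congr (_ ∘ _).
  rewrite -(comp_congr _ (ascV_nat _ _ _)) tensm_id !comp_assoc.
  congr (_ ∘ _ ∘ _); apply: heq_eq.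
  apply: heq_sym; do 2!(apply: heq_cast_r; first by auto with casts).
  apply: heq_cast_l; first by auto with casts.
  apply: heq_trans (heq_asc _ _ _) _.
  apply: heq_trans (heq_sym (heq_mid_of _ _ _)).
  by apply: heq_tensm (heq_refl _) (heq_front_tens _ _).
rewrite !F => e.
have {}e : mL ∘ (H ◁ f) ∘ dL = mL ∘ (H ◁ g) ∘ dL.
{ apply: conv_right_inj e; rewrite /mR /dR.
  - rewrite tensm_compr -!comp_assoc (comp_congr _ (asc_nat _ _ _)).
    rewrite -tensm_id (comp_congr _ (asc_nat _ _ _)).
    rewrite !(comp_assoc (H ◁ μ)) -!tensm_compl -mu_assoc.
    rewrite !(tensm_compl _ _ asc) -!comp_assoc; congr (_ ∘ _); casts.
  - rewrite -tensm_id -comp_assoc asc_nat comp_assoc -tensm_compl mu_eta_r.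
    casts.
  - rewrite tensm_compr -!comp_assoc -(comp_congr _ (ascV_nat _ _ _)).
    rewrite -tensm_id -(comp_congr _ (ascV_nat _ _ _)).
    rewrite -!tensm_compl coprod_assoc -comp_assoc (tensm_compl _ asc).
    by rewrite !comp_assoc; congr (_ ∘ _); casts.
  - rewrite -tensm_id comp_assoc -ascV_nat -comp_assoc -tensm_compl.
    rewrite counit_coprod_r; casts. }
apply: conv_left_inj e; rewrite /mL /dL.
- rewrite tensm_compl -!comp_assoc (comp_congr _ (ascV_nat _ _ _)).
  rewrite -tensm_id (comp_congr _ (ascV_nat _ _ _)).
  rewrite !(comp_assoc (μ ▷ H)) -!tensm_compr -mu_assoc.
  rewrite !tensm_compr -!comp_assoc; congr (_ ∘ (_ ∘ _)); casts.
- rewrite -tensm_id -comp_assoc ascV_nat comp_assoc -tensm_compr mu_eta_l.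
  casts.
- rewrite tensm_compl -!comp_assoc -(comp_congr _ (asc_nat _ _ _)).
  rewrite -tensm_id -(comp_congr _ (asc_nat _ _ _)).
  rewrite -!tensm_compr coprod_assoc -comp_assoc (tensm_compr _ asc).
  by rewrite !comp_assoc; congr (_ ∘ _); casts.
- rewrite -tensm_id comp_assoc -asc_nat -comp_assoc -tensm_compr.
  rewrite counit_coprod_l; casts.
Qed.

End ConvolutionAction.
End HopfPoints.

(** * Skew braces *)

Section SkewBraces.
Variable G : Type.

Record is_monoid (op : G -> G -> G) (e : G) : Prop := IsMonoid {
  opA : forall x y z, op x (op y z) = op (op x y) z;
  op1g : forall x, op e x = x;
  opg1 : forall x, op x e = x
}.

Record is_group (op : G -> G -> G) (e : G) (inv : G -> G) : Prop := IsGroup {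
  group_monoid : is_monoid op e;
  opVg : forall x, op (inv x) x = e;
  opgV : forall x, op x (inv x) = e
}.

(** Multiplying [x], [t x] and [t (t x)] in the two possible ways gives [t (t x) = x]. It is needed
    because the equation defining [T] yields only a right inverse for the second product. *)
Lemma right_inverse_left (op : G -> G -> G) (e : G) (t : G -> G) :
  is_monoid op e -> (forall x, op x (t x) = e) -> forall x, op (t x) x = e.
Proof.
move=> [A l r] h x; have e1 : t (t x) = x.
  by rewrite -(l (t (t x))) -(h x) -A h r.
by rewrite -{2}e1 h.
Qed.

Variables (op : G -> G -> G) (e : G) (inv : G -> G).
Hypothesis grp : is_group op e inv.
Local Notation "x * y" := (op x y).
Local Notation "x ^-1" := (inv x) (at level 3, format "x ^-1").
Let A := opA (group_monoid grp).
Let l1 := op1g (group_monoid grp).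
Let r1 := opg1 (group_monoid grp).
Let lV := opVg grp.
Let rV := opgV grp.

Lemma opKg x y : x^-1 * (x * y) = y.
Proof. by rewrite A lV l1. Qed.

Lemma opKVg x y : x * (x^-1 * y) = y.
Proof. by rewrite A rV l1. Qed.

Lemma op_cancel x y z : x * y = x * z -> y = z.
Proof. by move=> h; rewrite -(opKg x y) h opKg. Qed.

Lemma idempotent_one x : x * x = x -> x = e.
Proof. by move=> h; apply: (@op_cancel x); rewrite h r1. Qed.

Lemma inv_unique x y : x * y = e -> y = x^-1.
Proof. by move=> h; apply: (@op_cancel x); rewrite h rV. Qed.

Lemma invK x : (x^-1)^-1 = x.
Proof. by rewrite -(@inv_unique x^-1 x). Qed.

Lemma invM x y : (x * y)^-1 = y^-1 * x^-1.
Proof. by apply/eq_sym/inv_unique; rewrite -A opKVg rV. Qed.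

Section Action.
Variable act : G -> G -> G.
Hypothesis actM : forall x y z, act x (y * z) = act x y * act x z.
Hypothesis actA : forall x y z, act x (act y z) = act (x * act x y) z.

Lemma act_one x : act x e = e.
Proof. by apply: idempotent_one; rewrite -actM l1. Qed.

Lemma act_inv x y : act x y^-1 = (act x y)^-1.
Proof. by apply: inv_unique; rewrite -actM rV act_one. Qed.

Lemma action_monoid : (forall x, act e x = x) ->
  is_monoid (fun x y => x * act x y) e.
Proof.
move=> act1; split=> [x y z|x|x]; first by rewrite actM actA A.
  by rewrite l1 act1.
by rewrite act_one r1.
Qed.

(** By [actA] and [act_one] the operator of [e] is idempotent, and a left-invertible idempotent is
    the identity. This supplies the unit law that the axioms of post-Hopf algebras do not state. *)
Lemma unit_action (b : G -> G -> G) :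
  (forall x y, b x (act x y) = y) -> forall x, act e x = x.
Proof.
by move=> bK x; have := bK e (act e x); rewrite actA act_one l1 bK.
Qed.

End Action.

Section Brace.
Variables (op2 : G -> G -> G) (e2 : G) (inv2 : G -> G).
Hypothesis grp2 : is_group op2 e2 inv2.
Let act x y := x^-1 * op2 x y.
Hypothesis brace : forall x y z, op2 x (y * z) = op2 x y * act x z.

(** The brace law at [y = z = e] forces [act x e = e], while [act e2 e] unfolds to the inverse of
    [e2]. *)
Lemma brace_units : e2 = e.
Proof.
have h x : act x e = e.
  by apply: (@op_cancel (op2 x e)); rewrite -brace l1 r1.
have := h e2; rewrite /act (op1g (group_monoid grp2)) r1 => h2.
by rewrite -(invK e2) h2 -(@inv_unique e e).
Qed.

Lemma brace_actM x y z : act x (y * z) = act x y * act x z.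
Proof. by rewrite {1}/act brace A. Qed.

Lemma brace_act_one x : act e x = x.
Proof.
rewrite /act -(@inv_unique e e) // l1 -brace_units.
exact: op1g (group_monoid grp2) x.
Qed.

(** As [x * act x y] is [op2 x y], this says that the second group acts on the first; it comes from
    associativity of [op2]. *)
Lemma brace_actA x y z : act x (act y z) = act (x * act x y) z.
Proof.
rewrite {2 4}/act opKVg brace_actM (act_inv brace_actM) /act invM invK.
by rewrite -!A opKVg (opA (group_monoid grp2)).
Qed.

Lemma brace_act_inv_r x : act x (inv2 x) = x^-1.
Proof. by rewrite /act (opgV grp2) brace_units r1. Qed.

Lemma brace_act_inv_l x : act (inv2 x) x = (inv2 x)^-1.
Proof. by rewrite /act (opVg grp2) brace_units r1. Qed.

Lemma brace_act_invK x y : act (inv2 x) (act x y) = y.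
Proof. by rewrite brace_actA brace_act_inv_l rV brace_act_one. Qed.

Lemma brace_actK x y : act x (act (inv2 x) y) = y.
Proof. by rewrite brace_actA brace_act_inv_r rV brace_act_one. Qed.

End Brace.
End SkewBraces.

Lemma cmor2P (C : strict_braided_category) (H : coalgebra C)
  (m : hom (H ⊗ H) H) :
  is_coalgebra_morphism2 m <-> @is_cmor C (tens_coalg H H) H m.
Proof.
rewrite /is_cmor /is_coalgebra_morphism tens_coprodE tens_counitE.
by rewrite -mid_braidE.
Qed.

Lemma cmor_inverse (C : strict_braided_category) (X Y : coalgebra C)
  (f : hom X Y) (g : hom Y X) : is_cmor f -> inverse_pair f g -> is_cmor g.
Proof.
move=> [f1 f2] [gf fg]; split; first by rewrite -f1 -comp_assoc fg comp_idr.
rewrite -(comp_idr (coprod Y)) -fg (comp_assoc (coprod Y)) f2.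
by rewrite !comp_assoc -tensm_comp gf tensm_id comp_idl.
Qed.

(** * The group of points of a cocommutative Hopf algebra *)

Section Convolution.
Variables (C : strict_braided_category) (H : coalgebra C).
Variable S : hopf_structure H.
Implicit Types X : coalgebra C.

Lemma conv_assoc X (f g h : hom X H) :
  mu S ∘ pair f (mu S ∘ pair g h) = mu S ∘ pair (mu S ∘ pair f g) h.
Proof.
have := mu_assoc S => /(f_equal (fun k => k ∘ pair (pair f g) h)).
by rewrite -!comp_assoc asc_pair !tensm_pair !comp_idl.
Qed.

Lemma conv_unit_l X (f : hom X H) : mu S ∘ pair (eta S ∘ counit X) f = f.
Proof.
rewrite -(comp_idl f) -tensm_pair comp_assoc mu_eta_l comp_idl.
by rewrite pair_counit_l comp_assoc lunVK comp_idl.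
Qed.

Lemma conv_unit_r X (f : hom X H) : mu S ∘ pair f (eta S ∘ counit X) = f.
Proof.
rewrite -{1}(comp_idl f) -tensm_pair comp_assoc mu_eta_r.
by rewrite pair_counit_r comp_assoc runVK comp_idl.
Qed.

Lemma conv_antipode_r X (p : hom X H) : is_cmor p ->
  mu S ∘ pair p (antipode S ∘ p) = eta S ∘ counit X.
Proof.
move=> hp; rewrite -{1}(comp_idl p) -tensm_pair -coprod_comp // !comp_assoc.
by rewrite antipode_r -comp_assoc counit_comp.
Qed.

Lemma conv_antipode_l X (p : hom X H) : is_cmor p ->
  mu S ∘ pair (antipode S ∘ p) p = eta S ∘ counit X.
Proof.
move=> hp; rewrite -{2}(comp_idl p) -tensm_pair -coprod_comp // !comp_assoc.
by rewrite antipode_l -comp_assoc counit_comp.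
Qed.

Lemma mu_cmor : @is_cmor C (tens_coalg H H) H (mu S).
Proof.
apply/cmor2P; have [_ [_ [[_ h] [_ k]]]] := bialgebraP S.
by split=> //; rewrite k /tens_prod /tens_coprod comp_assoc.
Qed.

Lemma eta_counit_cmor X : is_cmor (eta S ∘ counit X).
Proof.
have [_ [_ [[h _] [k _]]]] := bialgebraP S; split.
  by rewrite comp_assoc h comp_idl.
rewrite comp_assoc k /tens_unit -comp_assoc -counit_coprod comp_assoc.
by rewrite -tensm_comp.
Qed.

Hypothesis hH : cocommutative H.

(* Schauenburg: on a cocommutative Hopf algebra the braiding is an involution,
   because the product is a coalgebra morphism both for [c] and for [c^-1], and
   the antipode recovers the braiding from either formula. *)
Lemma braid_involutive : braid H H ∘ braid H H = idm _.
Proof.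
have [b [bc cb]] := braid_iso H H.
suff e : b = braid H H by rewrite -{2}e cb.
apply: (bialgebra_prod_inj (S := S)).
have [_ k] := mu_cmor; move: k; rewrite tens_coprodE comp_assoc => <-.
apply: braid_mono; rewrite [in RHS]comp_assoc [in RHS]hH.
rewrite !comp_assoc braid_nat -(comp_assoc _ _ (mid_of b)) braid_mid_of //.
rewrite -!comp_assoc -tensm_comp [in LHS]hH.
by have [_ ->] := mu_cmor; rewrite tens_coprodE.
Qed.

Lemma tens_cocomm : cocommutative (tens_coalg H H).
Proof. exact: tens_cocommutative braid_involutive. Qed.

Lemma hopf_point_ext2 (Z : C) (u v : hom (H ⊗ H) Z) :
  (forall X (p q : hom X H), cocommutative X -> is_cmor p -> is_cmor q ->
     u ∘ pair p q = v ∘ pair p q) -> u = v.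
Proof. exact: point_ext2 hH hH braid_involutive. Qed.

(** Apply [point_ext2] to [H] and the coalgebra [H ⊗ H]. Their two braidings cancel because the
    hexagons split them into crossings of [H] with [H], and a point of [H ⊗ H] is the pair of its
    projections. *)
Lemma hopf_point_ext3 (Z : C) (u v : hom (H ⊗ (H ⊗ H)) Z) :
  (forall X (p q r : hom X H), cocommutative X ->
     is_cmor p -> is_cmor q -> is_cmor r ->
     u ∘ pair p (pair q r) = v ∘ pair p (pair q r)) -> u = v.
Proof.
move=> e; apply: (@point_ext2 C H (tens_coalg H H)) => //.
- exact: tens_cocomm.
- rewrite /= braid_tensr braid_tensl -!comp_assoc.
  rewrite (comp_congr1 _ (ascVK _ _ _)) comp_idl.
  rewrite (comp_congr1 _ (eq_sym (tensm_compl _ _ _))) braid_involutive.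
  rewrite tensm_id comp_idl (comp_congr1 _ (ascK _ _ _)) comp_idl.
  rewrite (comp_congr1 _ (eq_sym (tensm_compr _ _ _))) braid_involutive.
  by rewrite tensm_id comp_idl ascVK.
- move=> X p q hX hp hq.
  have -> : q = pair (fstp H H ∘ q) (sndp H H ∘ q).
    by rewrite -pair_comp // pair_fstp_sndp comp_idl.
  apply: e => //; apply: cmor_comp hq; [exact: fstp_cmor|exact: sndp_cmor].
Qed.

(* [(x, y) -> (x, xy)] is an isomorphism of coalgebras, so its inverse
   [(x, y) -> (x, x^-1 y)] is a coalgebra morphism; restrict to [y = 1]. *)
Lemma antipode_cmor : is_cmor (antipode S).
Proof.
pose th k := (H ◁ mu S) ∘ asc ∘ (((H ◁ k) ∘ coprod H) ▷ H).
have thE X (k : hom H H) (p q : hom X H) : is_cmor p ->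
    th k ∘ pair p q = pair p (mu S ∘ pair (k ∘ p) q).
  move=> hp; rewrite /th -!comp_assoc tensm_pair -!comp_assoc coprod_comp //.
  by rewrite tensm_pair asc_pair tensm_pair !comp_idl.
have f_cmor := fstp_cmor H H; have s_cmor := sndp_cmor H H.
have thT k : th k = pair (fstp H H) (mu S ∘ pair (k ∘ fstp H H) (sndp H H)).
  by rewrite -thE // pair_fstp_sndp comp_idr.
have thC : @is_cmor C (tens_coalg H H) (tens_coalg H H) (th (idm H)).
  rewrite thT; apply: pair_cmor => //; first exact: tens_cocomm.
  rewrite comp_idl pair_fstp_sndp comp_idr; exact: mu_cmor.
have thI : @inverse_pair C (H ⊗ H) (H ⊗ H) (th (idm H)) (th (antipode S)).
  split; [rewrite (thT (idm H))|rewrite (thT (antipode S))];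
    apply: eq_trans (thE _ _ _ _ f_cmor) _.
    rewrite comp_idl conv_assoc conv_antipode_l // conv_unit_l.
    exact: pair_fstp_sndp.
  rewrite comp_idl conv_assoc conv_antipode_r // conv_unit_l.
  exact: pair_fstp_sndp.
have thVC : @is_cmor C (tens_coalg H H) (tens_coalg H H) (th (antipode S)).
  exact: cmor_inverse thC thI.
have h : @is_cmor C H (tens_coalg H H) (pair (idm H) (eta S ∘ counit H)).
  by apply: pair_cmor => //; [apply: cmor_id|apply: eta_counit_cmor].
have := cmor_comp s_cmor (cmor_comp thVC h).
rewrite (thE _ _ _ _ (cmor_id H)).
by rewrite comp_idr conv_unit_r sndp_pair //; apply: cmor_id.
Qed.

End Convolution.

Section Points.
Variables (C : strict_braided_category).

(** Bundled so that points form a type, able to serve as the carrier [G] in the lemmas on skew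
    braces. *)
Record point (X Y : coalgebra C) := Point { pt :> hom X Y; ptP : is_cmor pt }.

Lemma point_eq X Y (p q : point X Y) : pt p = pt q -> p = q.
Proof.
by case: p q => [p hp] [q hq] /= e; move: hp; rewrite e => hp;
  rewrite (proof_irrelevance _ hp hq).
Qed.

Definition point_comp (X Y Z : coalgebra C) (g : hom Y Z) (hg : is_cmor g)
  (p : point X Y) : point X Z := Point (cmor_comp hg (ptP p)).

Variables (X H : coalgebra C) (hX : cocommutative X).

Definition point_op (m : hom (H ⊗ H) H)
  (hm : @is_cmor C (tens_coalg H H) H m) (p q : point X H) : point X H :=
  Point (cmor_comp hm (pair_cmor hX (ptP p) (ptP q))).

Variable S : hopf_structure H.

Definition point_one : point X H := Point (eta_counit_cmor S X).

Lemma point_group (hH : cocommutative H) :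
  is_group (point_op (mu_cmor S)) point_one
    (point_comp (antipode_cmor S hH)).
Proof.
split; first split.
- by move=> x y z; apply: point_eq; rewrite /= conv_assoc.
- by move=> x; apply: point_eq; rewrite /= conv_unit_l.
- by move=> x; apply: point_eq; rewrite /= conv_unit_r.
- by move=> x; apply: point_eq; rewrite /= conv_antipode_l; case: x.
- by move=> x; apply: point_eq; rewrite /= conv_antipode_r; case: x.
Qed.

End Points.

(** * Axioms for actions, read on points *)

Section PointwiseLaws.
Variables (C : strict_braided_category) (A : hopf_algebra C).
Hypothesis hA : cocommutative A.
Local Notation S := (hopf_str A).
Local Notation act2 := (@is_cmor C (tens_coalg A A) A).

Lemma sub_adjacent_pair (m : hom (A ⊗ A) A) (X : coalgebra C)
  (p q : hom X A) : is_cmor p ->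
  sub_adjacent_prod m ∘ pair p q = mu S ∘ pair p (m ∘ pair p q).
Proof.
move=> hp; rewrite /sub_adjacent_prod -!comp_assoc tensm_pair coprod_comp //.
by rewrite asc_pair tensm_pair !comp_idl.
Qed.

Lemma point_of_tens (Z : C) (u v : hom (A ⊗ A) Z) :
  u ∘ pair (fstp A A) (sndp A A) = v -> u = v.
Proof. by rewrite pair_fstp_sndp comp_idr. Qed.

Lemma sub_adjacent_cmor (m : hom (A ⊗ A) A) :
  act2 m -> act2 (sub_adjacent_prod m).
Proof.
move=> hm; have := sub_adjacent_pair m (sndp A A) (fstp_cmor A A).
move/point_of_tens => ->; apply: cmor_comp (mu_cmor S) _.
apply: pair_cmor; [exact: (tens_cocomm S)|exact: fstp_cmor|].
by rewrite pair_fstp_sndp comp_idr.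
Qed.

Lemma acts_on_prodP (m : hom (A ⊗ A) A) (hm : act2 m) :
  acts_on_prod m <->
  forall X (hX : cocommutative X) (x y z : point X A),
    point_op hX hm x (point_op hX (mu_cmor S) y z)
    = point_op hX (mu_cmor S) (point_op hX hm x y) (point_op hX hm x z).
Proof.
have L (X : coalgebra C) (x y z : hom X A) : m ∘ (A ◁ mu S) ∘ pair x (pair y z)
    = m ∘ pair x (mu S ∘ pair y z).
  by rewrite -comp_assoc tensm_pair comp_idl.
have R (X : coalgebra C) (x y z : hom X A) : cocommutative X -> is_cmor x ->
    mu S ∘ (m ⊠ m) ∘ mid_braid ∘ (coprod A ▷ (A ⊗ A)) ∘ pair x (pair y z)
    = mu S ∘ pair (m ∘ pair x y) (m ∘ pair x z).
  move=> hX hx; rewrite mid_braidE -!comp_assoc tensm_pair coprod_comp //.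
  by rewrite comp_idl mid_of_pair // tensm_pair.
split=> [e X hX x y z|e].
  apply: point_eq; rewrite /= -L e R //; exact: ptP.
apply: (hopf_point_ext3 S hA) => X x y z hX hx hy hz; rewrite L R //.
exact: (f_equal (@pt _ _ _) (e X hX (Point hx) (Point hy) (Point hz))).
Qed.

Lemma weak_actionP (m : hom (A ⊗ A) A) (hm : act2 m) :
  weak_action m <->
  forall X (hX : cocommutative X) (x y z : point X A),
    point_op hX hm x (point_op hX hm y z)
    = point_op hX hm (point_op hX (mu_cmor S) x (point_op hX hm x y)) z.
Proof.
have L (X : coalgebra C) (x y z : hom X A) : m ∘ (A ◁ m) ∘ pair x (pair y z)
    = m ∘ pair x (m ∘ pair y z).
  by rewrite -comp_assoc tensm_pair comp_idl.
have R (X : coalgebra C) (x y z : hom X A) : is_cmor x ->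
    m ∘ (sub_adjacent_prod m ▷ A) ∘ ascV ∘ pair x (pair y z)
    = m ∘ pair (mu S ∘ pair x (m ∘ pair x y)) z.
  move=> hx; rewrite -2!comp_assoc ascV_pair tensm_pair.
  by rewrite sub_adjacent_pair // comp_idl.
split=> [e X hX x y z|e].
  apply: point_eq; rewrite /= -L e R //; exact: ptP.
apply: (hopf_point_ext3 S hA) => X x y z hX hx hy hz; rewrite L R //.
exact: (f_equal (@pt _ _ _) (e X hX (Point hx) (Point hy) (Point hz))).
Qed.

(** A converse of [point_group]: the unit and antipode laws are read at the identity of [A], which
    is itself a point, and associativity on a generic triple. Compatibility with the coproduct is
    the assumption that [op] is a coalgebra morphism. *)
Lemma hopf_of_point_groups (op : hom (A ⊗ A) A) (hop : act2 op)
  (T : hom A A) (hT : is_cmor T) :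
  (forall X (hX : cocommutative X),
     is_group (point_op hX hop) (point_one X S) (point_comp hT)) ->
  is_bialgebra (eta S) op (counit A) (coprod A) /\
  is_antipode (eta S) op (counit A) (coprod A) T.
Proof.
move=> grp; have [_ [_ [[e1 _] [e2 _]]]] := bialgebraP S.
have [mon VT TV] := grp A hA; pose i : point A A := Point (cmor_id A).
split; last first.
  split; rewrite -pair_id -comp_assoc tensm_pair !comp_idl.
    exact: (f_equal (@pt _ _ _) (TV i)).
  exact: (f_equal (@pt _ _ _) (VT i)).
split.
  split.
    rewrite -[lunV]comp_idr -pair_counit_l -comp_assoc tensm_pair comp_idl.
    exact: (f_equal (@pt _ _ _) (op1g mon i)).
  split.
    rewrite -[runV]comp_idr -pair_counit_r -comp_assoc tensm_pair comp_idl.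
    exact: (f_equal (@pt _ _ _) (opg1 mon i)).
  rewrite -[RHS]comp_idr -(ascK A A A) comp_assoc; congr (_ ∘ _).
  apply: (hopf_point_ext3 S hA) => X x y z hX hx hy hz.
  rewrite -!comp_assoc ascV_pair !tensm_pair !comp_idl.
  exact: (f_equal (@pt _ _ _)
    (opA (group_monoid (grp X hX)) (Point hx) (Point hy) (Point hz))).
split; first exact: coalgebraP.
have [k1 k2] := (proj2 (cmor2P op)) hop.
split; first by split.
by split=> //; rewrite k2 /tens_prod /tens_coprod comp_assoc.
Qed.

Lemma sub_adjacent_hopf (m : hom (A ⊗ A) A) (hm : act2 m) (T : hom A A) :
  acts_on_prod m -> weak_action m -> is_cmor T ->
  (forall X (hX : cocommutative X) (x : point X A),
     point_op hX hm (point_one X S) x = x) ->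
  m ∘ (A ◁ T) ∘ coprod A = antipode S ->
  is_bialgebra (eta S) (sub_adjacent_prod m) (counit A) (coprod A) /\
  is_antipode (eta S) (sub_adjacent_prod m) (counit A) (coprod A) T.
Proof.
move=> mM mA hT m1 mT.
apply: (hopf_of_point_groups (hop := sub_adjacent_cmor hm) (hT := hT)).
move=> X hX; have grp := point_group hX S hA.
have E : point_op hX (sub_adjacent_cmor hm)
    = fun x y => point_op hX (mu_cmor S) x (point_op hX hm x y).
  do 2!apply: functional_extensionality => ?; apply: point_eq => /=.
  by rewrite sub_adjacent_pair //; apply: ptP.
have mon := action_monoid grp (proj1 (acts_on_prodP hm) mM X hX)
  (proj1 (weak_actionP hm) mA X hX) (m1 X hX).
(* The product of [x] and [T x] is [x (x . T x)], and [mT] identifies [x . T x] with the inverse of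
   [x]. *)
have inv_r x : point_op hX (sub_adjacent_cmor hm) x (point_comp hT x)
    = point_one X S.
  rewrite E -(opgV grp x); congr point_op; apply: point_eq => /=.
  rewrite -mT -2!comp_assoc (coprod_comp (ptP x)).
  by rewrite tensm_pair comp_idl.
rewrite -E in mon.
split=> //; exact: (right_inverse_left mon inv_r).
Qed.

End PointwiseLaws.

(** * Morphisms and equality of structures *)

Section HopfMorphisms.
Variables (C : strict_braided_category) (H B : coalgebra C).
Variables (SH : hopf_structure H) (SB : hopf_structure B) (f : hom H B).
Hypothesis hf : is_hopf_morphism SH SB f.

Lemma hopf_morphism_cmor : is_cmor f.
Proof. by case: hf. Qed.

Lemma hopf_morphism_conv (X : coalgebra C) (p q : hom X H) :
  f ∘ (mu SH ∘ pair p q) = mu SB ∘ pair (f ∘ p) (f ∘ q).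
Proof.
by have [[_ h] _] := hf; rewrite comp_assoc h -comp_assoc tensm_pair.
Qed.

(** Both sides are convolution inverses of [f]. *)
Lemma hopf_morphism_antipode : f ∘ antipode SH = antipode SB ∘ f.
Proof.
have [[e1 _] [e2 _]] := hf; have hf' := hopf_morphism_cmor.
rewrite -[LHS](conv_unit_r SB) -(conv_antipode_r SB hf') conv_assoc.
rewrite -{2}(comp_idr f) -hopf_morphism_conv -{1}(comp_idr (antipode SH)).
rewrite (conv_antipode_l SH (cmor_id H)) comp_assoc e1.
by rewrite conv_unit_l.
Qed.

End HopfMorphisms.

Lemma antipode_unique (C : strict_braided_category) (H : coalgebra C)
  (S S' : hopf_structure H) :
  eta S = eta S' -> mu S = mu S' -> antipode S = antipode S'.
Proof.
move=> e1 e2; have h : is_hopf_morphism S S' (idm H).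
  by do 2!split; rewrite ?tensm_id ?comp_idl ?comp_idr.
by have := hopf_morphism_antipode h; rewrite comp_idl comp_idr.
Qed.

Section BraceAction.
Variables (C : strict_braided_category) (H : coalgebra C).
Variables (S1 S2 : hopf_structure H).

Lemma brace_action_pair (X : coalgebra C) (p q : hom X H) : is_cmor p ->
  brace_action S1 S2 ∘ pair p q
  = mu S1 ∘ pair (antipode S1 ∘ p) (mu S2 ∘ pair p q).
Proof.
move=> hp; rewrite /brace_action -!comp_assoc tensm_pair coprod_comp //.
by rewrite asc_pair tensm_pair !comp_idl.
Qed.

Hypothesis hH : cocommutative H.

Lemma brace_action_cmor : @is_cmor C (tens_coalg H H) H (brace_action S1 S2).
Proof.
have e : brace_action S1 S2
    = mu S1 ∘ pair (antipode S1 ∘ fstp H H)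
        (mu S2 ∘ pair (fstp H H) (sndp H H)).
  by rewrite -brace_action_pair ?pair_fstp_sndp ?comp_idr //; apply: fstp_cmor.
rewrite e; apply: cmor_comp (mu_cmor S1) _; apply: pair_cmor.
- exact: (tens_cocomm S1).
- exact: cmor_comp (antipode_cmor S1 hH) (fstp_cmor H H).
- by rewrite pair_fstp_sndp comp_idr; apply: mu_cmor.
Qed.

Lemma hopf_brace_compatP :
  mu S2 ∘ (H ◁ mu S1)
    = mu S1 ∘ (mu S2 ⊠ brace_action S1 S2) ∘ mid_braid
        ∘ (coprod H ▷ (H ⊗ H)) <->
  forall X (hX : cocommutative X) (x y z : point X H),
    let op1 := point_op hX (mu_cmor S1) in
    let op2 := point_op hX (mu_cmor S2) in
    op2 x (op1 y z)
    = op1 (op2 x y) (op1 (point_comp (antipode_cmor S1 hH) x) (op2 x z)).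
Proof.
have L (X : coalgebra C) (x y z : hom X H) :
    mu S2 ∘ (H ◁ mu S1) ∘ pair x (pair y z) = mu S2 ∘ pair x (mu S1 ∘ pair y z).
  by rewrite -comp_assoc tensm_pair comp_idl.
have R (X : coalgebra C) (x y z : hom X H) : cocommutative X -> is_cmor x ->
    mu S1 ∘ (mu S2 ⊠ brace_action S1 S2) ∘ mid_braid ∘ (coprod H ▷ (H ⊗ H))
      ∘ pair x (pair y z)
    = mu S1 ∘ pair (mu S2 ∘ pair x y)
        (mu S1 ∘ pair (antipode S1 ∘ x) (mu S2 ∘ pair x z)).
  move=> hX hx; rewrite mid_braidE -3!comp_assoc tensm_pair coprod_comp //.
  by rewrite comp_idl mid_of_pair // tensm_pair brace_action_pair.
split=> [e X hX x y z|e].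
  apply: point_eq; rewrite /= -L e R //; exact: ptP.
apply: (hopf_point_ext3 S1 hH) => X x y z hX hx hy hz; rewrite L R //.
exact: (f_equal (@pt _ _ _) (e X hX (Point hx) (Point hy) (Point hz))).
Qed.

End BraceAction.

Section StructureEquality.
Variable C : strict_braided_category.

(** This lets the round trips ignore how an antipode was obtained. *)
Lemma hopf_structure_eq (H : coalgebra C) (S S' : hopf_structure H) :
  eta S = eta S' -> mu S = mu S' -> S = S'.
Proof.
move=> e1 e2; have e3 := antipode_unique e1 e2; move: e3 e1 e2.
case: S S' => [h m l P Q] [h' m' l' P' Q'] /= e3 e1 e2.
move: P Q; rewrite e1 e2 e3 => P Q.
by rewrite (proof_irrelevance _ P P') (proof_irrelevance _ Q Q').
Qed.

(** Data on equal carriers are compared by transport along [e]. Here and in the two lemmas below,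
    every application takes [e] to be reflexivity, since the constructions keep the carrier. *)
Lemma hopf_brace_eq (B B' : hopf_brace C) (e : hbr_coalg B = hbr_coalg B') :
  eq_rect _ (@hopf_structure C) (hbr1 B) _ e = hbr1 B' ->
  eq_rect _ (@hopf_structure C) (hbr2 B) _ e = hbr2 B' -> B = B'.
Proof.
case: B B' e => [H S1 S2 P] [H' S1' S2' P'] /= e; destruct e => /= e1 e2.
by destruct e1, e2; rewrite (proof_irrelevance _ P P').
Qed.

Lemma brace_triple_eq (B B' : brace_triple C) (e : bt_alg B = bt_alg B') :
  eq_rect _ (fun A : hopf_algebra C => hom (A ⊗ A) A) (bt_gamma B) _ e
    = bt_gamma B' ->
  eq_rect _ (fun A : hopf_algebra C => hom A A) (bt_T B) _ e = bt_T B' ->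
  B = B'.
Proof.
case: B B' e => [A g T p1 p2 p3 p4 p5 p6 p7 p8 p9 p10 p11 p12].
case=> [A' g' T' q1 q2 q3 q4 q5 q6 q7 q8 q9 q10 q11 q12] /= e.
destruct e => /= e1 e2; destruct e1, e2; f_equal; exact: proof_irrelevance.
Qed.

Lemma post_hopf_eq (B B' : post_hopf_algebra C)
  (e : posthopf_alg B = posthopf_alg B') :
  eq_rect _ (fun A : hopf_algebra C => hom (A ⊗ A) A) (posthopf_m B) _ e
    = posthopf_m B' -> B = B'.
Proof.
case: B B' e => [A m p1 p2 p3 p4 p5] [A' m' q1 q2 q3 q4 q5] /= e.
destruct e => /= e1; destruct e1; f_equal; exact: proof_irrelevance.
Qed.

End StructureEquality.

(** * Functors between categories of structured objects *)

Section FunctorEquality.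

(** Objects of a full subcategory carry proofs, so [E X] and [X] are equal without being
    convertible; morphisms are compared through [idm_eq]. *)
Lemma functor_eq_id (A : category) (E : functor A A)
  (ob_eq : forall X, E X = X)
  (hom_eq : forall X Y (f : hom X Y),
     idm_eq (ob_eq Y) ∘ fmap E f = f ∘ idm_eq (ob_eq X)) :
  E = functor_id A.
Proof.
case: E ob_eq hom_eq => [F M p q] /= ob_eq.
have e : F = fun X => X by apply: functional_extensionality.
move: M p q ob_eq; rewrite e => M p q ob_eq hom_eq.
have eM : M = fun X Y f => f.
  apply: functional_extensionality_dep => X.
  apply: functional_extensionality_dep => Y.
  apply: functional_extensionality_dep => f; move: (hom_eq X Y f).
  rewrite (proof_irrelevance _ (ob_eq X) eq_refl).
  rewrite (proof_irrelevance _ (ob_eq Y) eq_refl) /=.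
  by rewrite comp_idl comp_idr.
move: p q; rewrite /functor_id eM => p q.
by f_equal; apply: proof_irrelevance.
Qed.

(** Needed while the object maps are abstract and preserve underlying objects only up to a given
    equality. For the actual functors that equality is reflexivity and [transport_refl] removes
    it. *)
Definition transport (C : category) (A A' B B' : C) (eA : A' = A)
  (eB : B' = B) (f : hom A B) : hom A' B' :=
  idm_eq (eq_sym eB) ∘ f ∘ idm_eq eA.

Lemma transport_refl (C : category) (A B : C) (f : hom A B) :
  transport eq_refl eq_refl f = f.
Proof. by rewrite /transport /= comp_idl comp_idr. Qed.

Lemma transport_id (C : category) (A A' : C) (e : A' = A) :
  transport e e (idm A) = idm A'.
Proof. by destruct e; rewrite /transport /= !comp_idl. Qed.

Lemma transport_comp (C : category) (A A' B B' D D' : C) (eA : A' = A)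
  (eB : B' = B) (eD : D' = D) (g : hom B D) (f : hom A B) :
  transport eA eD (g ∘ f) = transport eB eD g ∘ transport eA eB f.
Proof.
by destruct eA, eB, eD; rewrite /transport /= !comp_idl !comp_idr.
Qed.

Lemma transport_round_trip (C : category) (A A' A'' B B' B'' : C)
  (eA : A' = A) (eA' : A'' = A') (eB : B' = B) (eB' : B'' = B')
  (kA : A'' = A) (kB : B'' = B) (f : hom A B) :
  idm_eq kB ∘ transport eA' eB' (transport eA eB f) = f ∘ idm_eq kA.
Proof.
destruct eA, eA', eB, eB'.
rewrite (proof_irrelevance _ kA eq_refl) (proof_irrelevance _ kB eq_refl).
by rewrite /transport /= !comp_idl !comp_idr.
Qed.

End FunctorEquality.

Section StructuredIsomorphism.
Variable C : category.

Local Notation structured S U P P_id P_comp Q :=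
  (@full_subcategory (@structured_category C S U P P_id P_comp) Q).

Lemma structured_hom_eq S (U : S -> C) P P_id P_comp (Q : S -> Prop)
  (X Y : structured S U P P_id P_comp Q) (f g : hom X Y) :
  proj1_sig f = proj1_sig g -> f = g.
Proof. by move=> e; apply: eq_sig_hprop e => *; apply: proof_irrelevance. Qed.

Lemma structured_idm_eq S (U : S -> C) P P_id P_comp (Q : S -> Prop)
  (X Y : structured S U P P_id P_comp Q) (e : X = Y)
  (e' : U (proj1_sig X) = U (proj1_sig Y)) :
  proj1_sig (idm_eq e) = idm_eq e'.
Proof. by destruct e; rewrite (proof_irrelevance _ e' eq_refl). Qed.

Section Functor.
Variables (S S' : Type) (U : S -> C) (U' : S' -> C).
Variables (P : forall X Y : S, hom (U X) (U Y) -> Prop)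
  (P' : forall X Y : S', hom (U' X) (U' Y) -> Prop).
Variables (P_id : forall X, P (idm (U X)))
  (P_comp : forall X Y Z (g : hom (U Y) (U Z)) (f : hom (U X) (U Y)),
     P g -> P f -> P (g ∘ f)).
Variables (P_id' : forall X, P' (idm (U' X)))
  (P_comp' : forall X Y Z (g : hom (U' Y) (U' Z)) (f : hom (U' X) (U' Y)),
     P' g -> P' f -> P' (g ∘ f)).
Variables (Q : S -> Prop) (Q' : S' -> Prop).
Variables (F : forall X, Q X -> S') (QF : forall X (q : Q X), Q' (F q)).
Variable UF : forall X (q : Q X), U' (F q) = U X.
Hypothesis PF : forall X Y (q : Q X) (r : Q Y) (f : hom (U X) (U Y)),
  P f -> P' (transport (UF q) (UF r) f).

Definition structured_functor :
  functor (structured S U P P_id P_comp Q)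
    (structured S' U' P' P_id' P_comp' Q').
Proof.
exists (fun X => exist _ (F (proj2_sig X)) (QF (proj2_sig X))
          : structured S' U' P' P_id' P_comp' Q')
  (fun X Y f => exist _ (transport (UF (proj2_sig X)) (UF (proj2_sig Y))
     (proj1_sig f)) (PF _ _ (proj2_sig f))).
- by move=> X; apply: structured_hom_eq; apply: transport_id.
- by move=> X Y Z g f; apply: structured_hom_eq; apply: transport_comp.
Defined.

End Functor.

Section RoundTrip.
Variables (S S' : Type) (U : S -> C) (U' : S' -> C).
Variables (P : forall X Y : S, hom (U X) (U Y) -> Prop)
  (P' : forall X Y : S', hom (U' X) (U' Y) -> Prop).
Variables (P_id : forall X, P (idm (U X)))
  (P_comp : forall X Y Z (g : hom (U Y) (U Z)) (f : hom (U X) (U Y)),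
     P g -> P f -> P (g ∘ f)).
Variables (P_id' : forall X, P' (idm (U' X)))
  (P_comp' : forall X Y Z (g : hom (U' Y) (U' Z)) (f : hom (U' X) (U' Y)),
     P' g -> P' f -> P' (g ∘ f)).
Variables (Q : S -> Prop) (Q' : S' -> Prop).
Variables (F : forall X, Q X -> S') (QF : forall X (q : Q X), Q' (F q)).
Variables (G : forall X, Q' X -> S) (QG : forall X (q : Q' X), Q (G q)).
Variable UF : forall X (q : Q X), U' (F q) = U X.
Variable UG : forall X (q : Q' X), U (G q) = U' X.
Hypothesis PF : forall X Y (q : Q X) (r : Q Y) (f : hom (U X) (U Y)),
  P f -> P' (transport (UF q) (UF r) f).
Hypothesis PG : forall X Y (q : Q' X) (r : Q' Y) (f : hom (U' X) (U' Y)),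
  P' f -> P (transport (UG q) (UG r) f).

(** Checking objects is enough: on morphisms both functors are transports of the same morphism of
    [C]. *)
Lemma structured_functor_round_trip :
  (forall X (q : Q X) (q' : Q' (F q)), G q' = X) ->
  functor_comp (structured_functor P_id' P_comp' P_id P_comp QG PG)
    (structured_functor P_id P_comp P_id' P_comp' QF PF) = functor_id _.
Proof.
move=> GF; set E := functor_comp _ _.
have ob_eq X : E X = X.
  by apply: eq_sig_hprop => [*|]; [apply: proof_irrelevance|apply: GF].
apply: (functor_eq_id (ob_eq := ob_eq)) => X Y f; apply: structured_hom_eq.
have kX := f_equal (fun Z => U (proj1_sig Z)) (ob_eq X).
have kY := f_equal (fun Z => U (proj1_sig Z)) (ob_eq Y).
rewrite /= (structured_idm_eq _ kX) (structured_idm_eq _ kY).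
exact: transport_round_trip.
Qed.

End RoundTrip.

Lemma structured_isomorphic (S S' : Type) (U : S -> C) (U' : S' -> C)
  (P : forall X Y : S, hom (U X) (U Y) -> Prop)
  (P' : forall X Y : S', hom (U' X) (U' Y) -> Prop)
  P_id P_comp P_id' P_comp' (Q : S -> Prop) (Q' : S' -> Prop)
  (F : forall X, Q X -> S') (QF : forall X (q : Q X), Q' (F X q))
  (G : forall X, Q' X -> S) (QG : forall X (q : Q' X), Q (G X q))
  (UF : forall X (q : Q X), U' (F X q) = U X)
  (UG : forall X (q : Q' X), U (G X q) = U' X) :
  (forall X Y (q : Q X) (r : Q Y) (f : hom (U X) (U Y)),
    P X Y f -> P' _ _ (transport (UF X q) (UF Y r) f)) ->
  (forall X Y (q : Q' X) (r : Q' Y) (f : hom (U' X) (U' Y)),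
    P' X Y f -> P _ _ (transport (UG X q) (UG Y r) f)) ->
  (forall X (q : Q X) (q' : Q' (F X q)), G _ q' = X) ->
  (forall X (q : Q' X) (q' : Q (G X q)), F _ q' = X) ->
  isomorphic_categories (structured S U P P_id P_comp Q)
    (structured S' U' P' P_id' P_comp' Q').
Proof.
move=> PF PG GF FG.
exists (structured_functor P_id P_comp P_id' P_comp' QF PF),
  (structured_functor P_id' P_comp' P_id P_comp QG PG).
by split; apply: structured_functor_round_trip.
Qed.

End StructuredIsomorphism.

Lemma isomorphic_categories_trans (A B D : category) :
  isomorphic_categories A B -> isomorphic_categories B D ->
  isomorphic_categories A D.
Proof.
have asc_eq (E1 E2 E3 E4 : category) (H : functor E3 E4) (G : functor E2 E3)
    (F : functor E1 E2) :
  functor_comp H (functor_comp G F) = functor_comp (functor_comp H G) F.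
  by rewrite /functor_comp; f_equal; apply: proof_irrelevance.
have id_l (E1 E2 : category) (F : functor E1 E2) :
  functor_comp (functor_id _) F = F.
  by case: F => *; rewrite /functor_comp; f_equal; apply: proof_irrelevance.
move=> [F [G [GF FG]]] [F' [G' [GF' FG']]].
exists (functor_comp F' F), (functor_comp G G'); split.
  by rewrite -asc_eq (asc_eq _ _ _ _ G') GF' id_l.
by rewrite -asc_eq (asc_eq _ _ _ _ F) FG id_l.
Qed.

(** * Hopf braces and brace triples *)

Section BraceOfAction.
Variables (C : strict_braided_category) (A : hopf_algebra C).
Variables (m : hom (A ⊗ A) A) (T : hom A A).
Local Notation S := (hopf_str A).
Hypothesis hA : cocommutative A.
Hypothesis hm : @is_cmor C (tens_coalg A A) A m.
Hypotheses (mM : acts_on_prod m) (mA : weak_action m) (hT : is_cmor T).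
Hypothesis m1 : forall X (hX : cocommutative X) (x : point X A),
  point_op hX hm (point_one X S) x = x.
Hypothesis mT : m ∘ (A ◁ T) ∘ coprod A = antipode S.

Let laws := sub_adjacent_hopf hA mM mA hT m1 mT.

Definition sub_adjacent_hopf_structure : hopf_structure A :=
  HopfStructure (proj1 laws) (proj2 laws).
Local Notation S' := sub_adjacent_hopf_structure.

Lemma brace_action_sub_adjacent : brace_action S S' = m.
Proof.
apply: (hopf_point_ext2 S hA) => X p q hX hp hq.
rewrite brace_action_pair // sub_adjacent_pair // conv_assoc.
by rewrite conv_antipode_l // conv_unit_l.
Qed.

Lemma sub_adjacent_compat :
  mu S' ∘ (A ◁ mu S)
    = mu S ∘ (mu S' ⊠ brace_action S S') ∘ mid_braid ∘ (coprod A ▷ (A ⊗ A)).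
Proof.
apply/(hopf_brace_compatP S S' hA) => X hX x y z op1 op2.
have grp := point_group hX S hA.
have E u v : op2 u v = op1 u (point_op hX hm u v).
  by apply: point_eq; rewrite /= sub_adjacent_pair //; apply: ptP.
rewrite !E /op1 (opKg grp) -(opA (group_monoid grp)).
congr (point_op _ _ _).
exact: (proj1 (acts_on_prodP hA hm) mM).
Qed.

(** Shared by brace triples and post-Hopf algebras, which differ in where [T] and the unit law [m1]
    come from. *)
Definition brace_of_action : hopf_brace C := HopfBrace sub_adjacent_compat.

End BraceOfAction.

Section BraceOfTriple.
Variables (C : strict_braided_category) (B : brace_triple C).
Hypothesis hB : cocommutative B.

Lemma bt_gamma_cmor : @is_cmor C (tens_coalg B B) B (bt_gamma B).
Proof. exact/cmor2P/bt_coalg. Qed.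

(** The axiom makes [T] reverse the coproduct; under cocommutativity this is the same as preserving
    it. *)
Lemma bt_T_cmor : is_cmor (bt_T B).
Proof.
split; first exact: bt_T_counit.
by rewrite bt_T_coprod braid_nat -comp_assoc hB.
Qed.

Lemma bt_act_one (X : coalgebra C) (hX : cocommutative X) (x : point X B) :
  point_op hX bt_gamma_cmor (point_one X (hopf_str B)) x = x.
Proof.
apply: point_eq; rewrite /= -(comp_idl (pt x)) -tensm_pair pair_counit_l.
by rewrite !comp_assoc bt_unit.
Qed.

Definition brace_of_triple : hopf_brace C :=
  brace_of_action hB (bt_prod B) (bt_act B) bt_T_cmor bt_act_one
    (bt_T_right B).

End BraceOfTriple.

(** * From Hopf braces to brace triples *)

Section TripleOfBrace.
Variables (C : strict_braided_category) (B : hopf_brace C).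
Hypothesis hB : cocommutative B.
Local Notation S1 := (hbr1 B).
Local Notation S2 := (hbr2 B).
Local Notation Γ := (brace_action S1 S2).

Let gamma_cmor := brace_action_cmor S1 S2 hB.
Let A := HopfAlgebra S1.

Section OnPoints.
Variables (X : coalgebra C) (hX : cocommutative X).
Local Notation inv1 := (point_comp (antipode_cmor S1 hB)).
Local Notation act :=
  (fun x y => point_op hX (mu_cmor S1) (inv1 x) (point_op hX (mu_cmor S2) x y)).

Lemma hbr_act_point (x y : point X B) : point_op hX gamma_cmor x y = act x y.
Proof. by apply: point_eq; rewrite /= brace_action_pair //; apply: ptP. Qed.

Lemma hbr_brace_point (x y z : point X B) :
  point_op hX (mu_cmor S2) x (point_op hX (mu_cmor S1) y z)
  = point_op hX (mu_cmor S1) (point_op hX (mu_cmor S2) x y) (act x z).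
Proof. exact: (proj1 (hopf_brace_compatP S1 S2 hB) (hbr_compat B)). Qed.

End OnPoints.

Lemma hbr_eta : eta S2 = eta S1.
Proof.
have := f_equal (@pt _ _ _) (brace_units (point_group hB S1 hB)
  (point_group hB S2 hB) (hbr_brace_point hB)).
(* On points the units are [eta ∘ counit]; precomposing with [eta S1] cancels the counit. *)
move=> /(f_equal (fun k => k ∘ eta S1)) /=; rewrite -!comp_assoc.
by have [_ [_ [[-> _] _]]] := bialgebraP S1; rewrite !comp_idr.
Qed.

Lemma hbr_acts_on_prod : @acts_on_prod C A Γ.
Proof.
apply/(acts_on_prodP (A := A) hB gamma_cmor) => X hX x y z.
rewrite !hbr_act_point.
exact: (brace_actM (point_group hX S1 hB) (hbr_brace_point hX)).
Qed.

Lemma hbr_weak_action : @weak_action C A Γ.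
Proof.
apply/(weak_actionP (A := A) hB gamma_cmor) => X hX x y z.
rewrite !hbr_act_point.
exact: (brace_actA (point_group hX S1 hB) (point_group hX S2 hB)
  (hbr_brace_point hX)).
Qed.

Lemma sub_adjacent_brace_action : @sub_adjacent_prod C A Γ = mu S2.
Proof.
apply: (hopf_point_ext2 S1 hB) => X p q hX hp hq.
rewrite (sub_adjacent_pair (A := A)) // brace_action_pair // conv_assoc.
by rewrite conv_antipode_r // conv_unit_l.
Qed.

Lemma antipode_involutive (H : coalgebra C) (S : hopf_structure H) :
  cocommutative H -> inverse_pair (antipode S) (antipode S).
Proof.
move=> hH; have := invK (point_group hH S hH) (Point (cmor_id H)).
by move=> /(f_equal (@pt _ _ _)) /=; rewrite comp_idr.
Qed.

Let T_coprod : coprod B ∘ antipode S2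
  = braid B B ∘ (antipode S2 ⊠ antipode S2) ∘ coprod B.
Proof.
have [_ ->] := antipode_cmor S2 hB.
by rewrite braid_nat -comp_assoc hB.
Qed.

Let T_prod : mu S1 ∘ (B ◁ Γ) ∘ asc ∘ ((coprod B ∘ antipode S2) ▷ B)
  = mu S1 ∘ (B ◁ Γ) ∘ asc
      ∘ (((antipode S2 ⊠ antipode S2) ∘ coprod B) ▷ B).
Proof. by have [_ ->] := antipode_cmor S2 hB. Qed.

Let T_right : Γ ∘ (B ◁ antipode S2) ∘ coprod B = antipode S1.
Proof.
rewrite -pair_id -comp_assoc tensm_pair comp_idl comp_idr.
rewrite (brace_action_pair S1 S2 _ (cmor_id B)).
rewrite -{1}(comp_idr (antipode S2)) (conv_antipode_r S2 (cmor_id B)).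
by rewrite hbr_eta conv_unit_r comp_idr.
Qed.

(** On elements, [T x . x] is the first inverse of [T x] times the second product of [T x] and [x],
    which is 1. As the first antipode is an involution, [lambdaV] equals it. *)
Let T_left (lambdaV : hom B B) : inverse_pair (antipode S1) lambdaV ->
  Γ ∘ (antipode S2 ▷ B) ∘ coprod B = lambdaV ∘ antipode S2.
Proof.
move=> [h _]; have [k _] := antipode_involutive S1 hB.
have -> : lambdaV = antipode S1.
  by rewrite -(comp_idr lambdaV) -k comp_assoc h comp_idl.
rewrite -pair_id -comp_assoc tensm_pair comp_idl comp_idr.
rewrite (brace_action_pair S1 S2 _ (antipode_cmor S2 hB)).
rewrite -{2}(comp_idr (antipode S2)) (conv_antipode_l S2 (cmor_id B)).
by rewrite hbr_eta conv_unit_r.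
Qed.

Let act_unit : Γ ∘ (eta S1 ▷ B) ∘ lunV = idm B.
Proof.
rewrite -[lunV]comp_idr -pair_counit_l -comp_assoc tensm_pair comp_idl.
have := brace_act_one (point_group hB S1 hB) (point_group hB S2 hB)
  (hbr_brace_point hB) (Point (cmor_id B)).
by rewrite -hbr_act_point; apply: (f_equal (@pt _ _ _)).
Qed.

Let cocomm_class :
  (Γ ▷ B) ∘ ascV ∘ (B ◁ braid B B) ∘ asc ∘ (coprod B ▷ B)
  = (Γ ▷ B) ∘ ascV ∘ (B ◁ braid B B) ∘ asc
      ∘ ((braid B B ∘ coprod B) ▷ B).
Proof. by rewrite hB. Qed.

Definition triple_of_brace : brace_triple C :=
  @BraceTriple C A Γ (antipode S2)
    (ex_intro _ _ (antipode_involutive S1 hB)) cocomm_class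
    ((proj2 (cmor2P Γ)) gamma_cmor) hbr_acts_on_prod hbr_weak_action act_unit
    (ex_intro _ _ (antipode_involutive S2 hB)) T_coprod
    (proj1 (antipode_cmor S2 hB)) T_prod T_right T_left.

End TripleOfBrace.

(** * Hopf braces and post-Hopf algebras *)

Section Transposition.
Variables (C : strict_braided_category) (H : coalgebra C) (D : dual H).
Local Notation "H*" := (dual_ob D).

(** Compatibility of the adjunction with tensoring on the right determines the counit from [ev], its
    component at the unit object. *)
Lemma adj_counitE (Y : C) : adj_counit D Y = lun ∘ (ev D ▷ Y) ∘ ascV.
Proof.
have h := adj_counit_nat D (@lun C Y); rewrite adj_counit_tens in h.
have {}h := f_equal (fun k => k ∘ (H ◁ (H* ◁ lunV))) h; move: h => /=.
rewrite -comp_assoc -!tensm_compl lunVK !tensm_id comp_idr => ->.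
rewrite /ev tensm_compr -!comp_assoc; congr (_ ∘ (_ ∘ _)); casts.
Qed.

Lemma beta_tildeE (b : hom H (H* ⊗ H)) :
  beta_tilde b = adj_counit D H ∘ (H ◁ b).
Proof. by rewrite adj_counitE. Qed.

(** [beta_tilde] is the transposition bijection of the adjunction; the witness is the transpose of
    [t], and the triangle identities give both directions. *)
Lemma beta_tilde_surj (t : hom (H ⊗ H) H) :
  exists b : hom H (H* ⊗ H), beta_tilde b = t.
Proof.
exists ((H* ◁ t) ∘ adj_unit D H).
rewrite beta_tildeE tensm_compl comp_assoc adj_counit_nat -comp_assoc.
by rewrite adj_triangle_l comp_idr.
Qed.

Lemma beta_tilde_inj (a b : hom H (H* ⊗ H)) :
  beta_tilde a = beta_tilde b -> a = b.
Proof.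
have K (d : hom H (H* ⊗ H)) : (H* ◁ beta_tilde d) ∘ adj_unit D H = d.
  rewrite beta_tildeE tensm_compl -comp_assoc -adj_unit_nat comp_assoc.
  by rewrite adj_triangle_r comp_idl.
by move=> e; rewrite -(K a) -(K b) e.
Qed.

(** Under transposition, convolution becomes composition of operators, that of [a] being applied
    first. *)
Lemma beta_tilde_end_prod (a b : hom H (H* ⊗ H)) :
  beta_tilde (end_prod D ∘ (a ⊠ b) ∘ coprod H)
  = beta_tilde b ∘ (beta_tilde a ▷ H) ∘ ascV ∘ (H ◁ coprod H).
Proof.
have -> : end_prod D = (H* ◁ adj_counit D H) ∘ asc.
  by rewrite /end_prod -adj_counitE.
rewrite !beta_tildeE !tensm_compl -!comp_assoc.
rewrite (comp_congr _ (adj_counit_nat D (adj_counit D H))) adj_counit_tens.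
rewrite -!comp_assoc (comp_congr1 _ (eq_sym (tensm_compl _ _ _))) ascK tensm_id.
rewrite comp_idl tensm_compr (comp_congr _ (ascV_nat _ _ _)).
rewrite !comp_assoc; congr (_ ∘ _ ∘ _).
rewrite -!comp_assoc; congr (_ ∘ _); rewrite comp_assoc -!tensm_comp.
by rewrite !comp_idl !comp_idr.
Qed.

Lemma adj_counit_coev : adj_counit D H ∘ (H ◁ coev D) = run.
Proof.
by rewrite /coev tensm_compl comp_assoc adj_counit_nat -comp_assoc
  adj_triangle_l comp_idr.
Qed.

Lemma beta_tilde_unit :
  beta_tilde (lun ∘ (counit H ⊠ coev D) ∘ runV) = run ∘ (H ◁ counit H).
Proof.
have -> : lun ∘ (counit H ⊠ coev D) ∘ runV = coev D ∘ counit H.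
  rewrite tensm_split comp_assoc lun_nat -2!comp_assoc -runV_nat.
  by rewrite (comp_assoc lun) cast_inverse ?comp_idl; auto with casts.
by rewrite beta_tildeE tensm_compl comp_assoc adj_counit_coev.
Qed.

(* Sliding [ev] through [c_{H,H*}] turns it into the inverse of [c_{H,H}]. *)
Lemma beta_tilde_alpha (m : hom (H ⊗ H) H) :
  beta_tilde (alpha D m) ∘ braid H H = m.
Proof.
have evb : lun ∘ (ev D ▷ H) ∘ ascV ∘ (H ◁ braid H H*)
      ∘ asc ∘ (braid H H ▷ H*) ∘ ascV = run ∘ (H ◁ ev D).
  have := braid_nat (idm H) (ev D); rewrite braid_tensr braid_unit_r.
  move/(f_equal (fun k => lun ∘ k)); rewrite !comp_assoc => <-.
  by rewrite lunVK comp_idl.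
have evk : (ev D ▷ H) ∘ ascV ∘ (H ◁ coev D) = lunV ∘ run.
  by rewrite -adj_counit_coev adj_counitE !comp_assoc lunK comp_idl.
rewrite -adj_counitE in evb.
rewrite beta_tildeE /alpha; move: (coev D) (ev D) evk evb => k e evk evb.
(* [mv] creates the dual pair after the crossing of [H] with [H] instead of before it, which brings
   that crossing next to [evb]. *)
have mv : ascV ∘ (H ◁ ascV) ∘ (H ◁ (H ◁ k)) ∘ (H ◁ runV) ∘ braid H H
  = ((asc ∘ (braid H H ▷ H*) ∘ ascV) ▷ H)
      ∘ (ascV ∘ (H ◁ ascV) ∘ (H ◁ (H ◁ k)) ∘ (H ◁ runV)).
  have -> : (H ◁ runV) = asc ∘ @runV C (H ⊗ H) by casts.
  rewrite -!comp_assoc runV_nat !(comp_congr _ (eq_sym (asc_nat _ _ _))).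
  rewrite tensm_id (comp_assoc _ (braid H H ▷ _)) -tensm_split.
  rewrite (tensm_split' (braid H H)) !comp_assoc; congr (_ ∘ _ ∘ _).
  rewrite -(comp_assoc _ _ asc); apply: heq_eq.
  apply: heq_trans (_ : heq _ (braid H H ▷ H* ▷ H)) _.
    rewrite -!comp_assoc; do 3!(apply: heq_cast_l; first by auto with casts).
    exact: heq_whisker_assoc_r.
  apply: heq_sym.
  do 3!(apply: heq_cast_r; first by auto with casts).
  rewrite !tensm_compr; apply: heq_cast_r; first by auto with casts.
  by apply: heq_cast_l; [auto with casts|apply: heq_refl].
rewrite !tensm_compl -!comp_assoc (comp_congr _ (adj_counit_nat D m)).
rewrite adj_counit_tens -[RHS]comp_idr; congr (_ ∘ _).
rewrite -!comp_assoc (comp_congr1 _ (eq_sym (tensm_compl _ _ _))).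
rewrite ascK tensm_id comp_idl (comp_congr _ (ascV_nat _ _ _)).
rewrite -!comp_assoc in mv evb evk; rewrite mv.
rewrite !(comp_congr1 _ (eq_sym (tensm_compr _ _ _))) -!comp_assoc evb.
rewrite tensm_compr -comp_assoc -(comp_congr _ (ascV_nat _ _ _)).
do 3!rewrite -tensm_compl; rewrite !comp_assoc -(comp_assoc _ _ runV).
rewrite (comp_assoc (_ ∘ ascV)) -(comp_assoc (e ▷ H) ascV) evk -comp_assoc.
casts.
Qed.

Variable S : hopf_structure H.
Hypothesis hH : cocommutative H.

(** The two convolution equations say that the operators of [x] under [m] and [beta_tilde b] are
    mutually inverse. [beta_tilde b] takes the element acted upon first, because [ev] pairs the
    first factor with the dual. *)
Lemma convolution_inverseP (m : hom (H ⊗ H) H) (b : hom H (H* ⊗ H)) :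
  @is_convolution_inverse C H D (alpha D m) b <->
  forall (X : coalgebra C) (x y : hom X H), cocommutative X ->
    is_cmor x -> is_cmor y ->
    beta_tilde b ∘ pair (m ∘ pair x y) x = y /\
    m ∘ pair x (beta_tilde b ∘ pair y x) = y.
Proof.
have am (X : coalgebra C) (u v : hom X H) : cocommutative X ->
    beta_tilde (alpha D m) ∘ pair u v = m ∘ pair v u.
  by move=> hX; rewrite -{2}(beta_tilde_alpha m) -comp_assoc braid_pair.
have conv (X : coalgebra C) (s t : hom (H ⊗ H) H) (u v : hom X H) : is_cmor v ->
    t ∘ (s ▷ H) ∘ ascV ∘ (H ◁ coprod H) ∘ pair u v
    = t ∘ pair (s ∘ pair u v) v.
  move=> hv; rewrite -!comp_assoc tensm_pair coprod_comp // ascV_pair.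
  by rewrite tensm_pair !comp_idl.
have unit (X : coalgebra C) (u v : hom X H) : is_cmor v ->
    run ∘ (H ◁ counit H) ∘ pair u v = u.
  move=> hv; rewrite -comp_assoc tensm_pair counit_comp // pair_counit_r.
  by rewrite comp_idl comp_assoc runVK comp_idl.
split=> [[e1 e2] X x y hX hx hy|e].
  move: (f_equal (fun k => beta_tilde k) e1).
  move: (f_equal (fun k => beta_tilde k) e2).
  rewrite beta_tilde_unit !beta_tilde_end_prod => k2 k1; split.
    by rewrite -am // -conv // k1 unit.
  by rewrite -am // -conv // k2 unit.
split; apply: beta_tilde_inj; rewrite beta_tilde_unit beta_tilde_end_prod;
  apply: (hopf_point_ext2 S hH) => X y x hX hy hx;
  rewrite conv // unit // am //.
  by have [] := e X x y hX hx hy.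
by have [] := e X x y hX hx hy.
Qed.

End Transposition.

(** * From Hopf braces to post-Hopf algebras *)

Section PostHopfOfBrace.
Variables (C : strict_braided_category) (B : hopf_brace C).
Hypothesis hB : cocommutative B.
Local Notation S1 := (hbr1 B).
Local Notation S2 := (hbr2 B).
Local Notation Γ := (brace_action S1 S2).

(** The inverse operators: [x] acts through its inverse for the second product, with the arguments
    in the order of [beta_tilde]. *)
Let t := Γ ∘ pair (antipode S2 ∘ sndp B B) (fstp B B).

Let t_cmor : @is_cmor C (tens_coalg B B) B t.
Proof.
apply: cmor_comp (brace_action_cmor S1 S2 hB) _; apply: pair_cmor.
- exact: (tens_cocomm S1).
- exact: cmor_comp (antipode_cmor S2 hB) (sndp_cmor B B).
- exact: fstp_cmor.
Qed.

Let t_pair (X : coalgebra C) (x y : hom X B) : cocommutative X ->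
  is_cmor x -> is_cmor y -> t ∘ pair y x = Γ ∘ pair (antipode S2 ∘ x) y.
Proof.
move=> hX hx hy; have hyx := pair_cmor hX hy hx.
rewrite /t -comp_assoc; congr (_ ∘ _).
apply: eq_trans (pair_comp _ _ hyx) _; rewrite -comp_assoc.
by rewrite sndp_pair // fstp_pair.
Qed.

Lemma hbr_act_invK (X : coalgebra C) (x y : hom X B) : cocommutative X ->
  is_cmor x -> is_cmor y ->
  Γ ∘ pair (antipode S2 ∘ x) (Γ ∘ pair x y) = y /\
  Γ ∘ pair x (Γ ∘ pair (antipode S2 ∘ x) y) = y.
Proof.
move=> hX hx hy.
pose g1 := point_group hX S1 hB; pose g2 := point_group hX S2 hB.
have h1 := brace_act_invK g1 g2 (hbr_brace_point hB hX) (Point hx) (Point hy).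
have h2 := brace_actK g1 g2 (hbr_brace_point hB hX) (Point hx) (Point hy).
move: h1 h2; rewrite -!hbr_act_point => h1 h2; split.
  exact: (f_equal (@pt _ _ _) h1).
exact: (f_equal (@pt _ _ _) h2).
Qed.

Lemma hbr_alpha_inverse (D : dual B) :
  exists b, is_convolution_inverse (alpha D Γ) b.
Proof.
have [b eb] := beta_tilde_surj D t.
exists b; apply/(convolution_inverseP S1 hB) => X x y hX hx hy.
have hg : is_cmor (Γ ∘ pair x y).
  exact: cmor_comp (brace_action_cmor S1 S2 hB) (pair_cmor hX hx hy).
by rewrite eb !t_pair //; apply: hbr_act_invK.
Qed.

Definition post_hopf_of_brace (fin : finite_ob B) : post_hopf_algebra C :=
  @PostHopfAlgebra C (HopfAlgebra S1) Γ fin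
    ((proj2 (cmor2P Γ)) (brace_action_cmor S1 S2 hB)) (hbr_weak_action hB)
    (hbr_acts_on_prod hB) hbr_alpha_inverse.

(** Inverse operators are unique, so [beta_tilde b] must be [t], a composite of coalgebra
    morphisms. *)
Lemma post_hopf_of_brace_star (fin : finite_ob B) :
  posthopf_star (post_hopf_of_brace fin).
Proof.
move=> D b hb.
have -> : beta_tilde b = t.
  apply: (hopf_point_ext2 S1 hB) => X y x hX hy hx; rewrite t_pair //.
  set z := Γ ∘ _.
  have hz : is_cmor z.
    apply: cmor_comp (brace_action_cmor S1 S2 hB) (pair_cmor hX _ hy).
    exact: cmor_comp (antipode_cmor S2 hB) hx.
  (* Write [y] as [x . z]; the inverse operator of [x] then returns [z]. *)
  have [_ e] := hbr_act_invK hX hx hy.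
  have [k _] := (proj1 (convolution_inverseP S1 hB _ b)) hb X x z hX hx hz.
  by rewrite -{1}e -/z.
have [_ ->] := t_cmor; rewrite tens_coprodE comp_assoc.
by rewrite mid_braidE.
Qed.

End PostHopfOfBrace.

(** * From post-Hopf algebras to Hopf braces *)

Section BraceOfPostHopf.
Variables (C : strict_braided_category) (B : post_hopf_algebra C).
Hypotheses (hB : cocommutative B) (star : posthopf_star B).
Local Notation S := (hopf_str B).
Local Notation m := (posthopf_m B).

Lemma posthopf_m_cmor : @is_cmor C (tens_coalg B B) B m.
Proof. exact/cmor2P/posthopf_coalg. Qed.

Lemma posthopf_inverse : exists β : hom (B ⊗ B) B,
  @is_cmor C (tens_coalg B B) B β /\
  forall (X : coalgebra C) (x y : hom X B), cocommutative X ->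
    is_cmor x -> is_cmor y ->
    β ∘ pair (m ∘ pair x y) x = y /\ m ∘ pair x (β ∘ pair y x) = y.
Proof.
have [D] := posthopf_finite B; have [b hb] := posthopf_inv D.
have K := (proj1 (convolution_inverseP S hB _ b)) hb.
exists (beta_tilde b); split=> //; split; last first.
  by rewrite (star hb) tens_coprodE mid_braidE comp_assoc.
(* [posthopf_star] covers only the coproduct. The counit follows by applying it to
   [y = x . β(y, x)], since [m] preserves counits. *)
rewrite tens_counitE; apply: (hopf_point_ext2 S hB) => X y x hX hy hx.
have [_ e] := K X x y hX hx hy.
rewrite -(comp_assoc lun) tensm_pair (counit_comp hx) (counit_comp hy).
rewrite pair_counit_l.
rewrite comp_assoc lunVK comp_idl -(counit_comp hy) -{2}e comp_assoc.
have [-> _] := posthopf_m_cmor; rewrite tens_counitE -(comp_assoc lun).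
rewrite tensm_pair (counit_comp hx) pair_counit_l !comp_assoc.
by rewrite lunVK comp_idl.
Qed.

Lemma posthopf_act_one (X : coalgebra C) (hX : cocommutative X)
  (x : point X B) : point_op hX posthopf_m_cmor (point_one X S) x = x.
Proof.
have [β [hβ K]] := posthopf_inverse.
have grp := point_group hX S hB.
apply: (unit_action grp _ _ (b := fun x y => point_op hX hβ y x)).
- exact: (proj1 (acts_on_prodP hB posthopf_m_cmor) (posthopf_prod B)).
- exact: (proj1 (weak_actionP hB posthopf_m_cmor) (posthopf_act B)).
- move=> u v; apply: point_eq => /=.
  by have [] := K X u v hX (ptP u) (ptP v).
Qed.

Lemma posthopf_antipode_exists : exists T : hom B B,
  is_cmor T /\ m ∘ (B ◁ T) ∘ coprod B = antipode S.
Proof.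
have [β [hβ K]] := posthopf_inverse.
have hl := antipode_cmor S hB; have hi := cmor_id B.
(* [T x] is the inverse operator of [x] applied to the inverse of [x], so [x . T x] is that
   inverse. *)
exists (β ∘ pair (antipode S) (idm B)); split.
  exact: cmor_comp hβ (pair_cmor hB hl hi).
rewrite -pair_id -comp_assoc tensm_pair comp_idl comp_idr.
by have [] := K B (idm B) (antipode S) hB hi hl.
Qed.

(** Finiteness and the convolution inverse are mere existence statements, so [T] has to be chosen;
    being an antipode for a fixed unit and product, it does not depend on the choice. *)
Let T := constructive_indefinite_description _ posthopf_antipode_exists.

Definition brace_of_post_hopf : hopf_brace C :=
  brace_of_action hB (posthopf_prod B) (posthopf_act B)
    (proj1 (proj2_sig T)) posthopf_act_one (proj2 (proj2_sig T)).

End BraceOfPostHopf.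

(** * The isomorphisms of categories *)

Section RoundTrips.
Variable C : strict_braided_category.

Lemma brace_of_triple_of_brace (B : hopf_brace C) (hB : cocommutative B)
  (hB' : cocommutative (triple_of_brace hB)) : brace_of_triple hB' = B.
Proof.
apply: (@hopf_brace_eq C (brace_of_triple hB') B eq_refl) => //.
apply: hopf_structure_eq; first by rewrite /= hbr_eta.
exact: sub_adjacent_brace_action.
Qed.

Lemma triple_of_brace_of_triple (B : brace_triple C) (hB : cocommutative B)
  (hB' : cocommutative (brace_of_triple hB)) : triple_of_brace hB' = B.
Proof.
(* The Hopf algebra obtained is [HopfAlgebra] applied to the projection [hopf_str]; it converts to
   the original one only after the record is destructed. *)
case: B hB hB' => [[H S] g T p1 p2 p3 p4 p5 p6 p7 p8 p9 p10 p11 p12] hB hB'.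
match goal with
| |- ?X = ?Y => apply: (@brace_triple_eq C X Y eq_refl) => //=
end.
exact: (brace_action_sub_adjacent (A := HopfAlgebra S)).
Qed.

Lemma brace_of_post_hopf_of_brace (B : hopf_brace C) (hB : cocommutative B)
  (fin : finite_ob B) (hB' : cocommutative (post_hopf_of_brace hB fin))
  (star : posthopf_star (post_hopf_of_brace hB fin)) :
  brace_of_post_hopf hB' star = B.
Proof.
apply: (@hopf_brace_eq C (brace_of_post_hopf hB' star) B eq_refl) => //.
apply: hopf_structure_eq; first by rewrite /= hbr_eta.
exact: sub_adjacent_brace_action.
Qed.

Lemma post_hopf_of_brace_of_post_hopf (B : post_hopf_algebra C)
  (hB : cocommutative B) (star : posthopf_star B)
  (hB' : cocommutative (brace_of_post_hopf hB star))
  (fin : finite_ob (brace_of_post_hopf hB star)) :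
  post_hopf_of_brace hB' fin = B.
Proof.
case: B hB star hB' fin => [[H S] m p1 p2 p3 p4 p5] hB star hB' fin.
match goal with
| |- ?X = ?Y => apply: (@post_hopf_eq C X Y eq_refl) => //=
end.
exact: (brace_action_sub_adjacent (A := HopfAlgebra S)).
Qed.

End RoundTrips.

(** * Morphisms and the assembly of the isomorphisms *)

Section Morphisms.
Variable C : strict_braided_category.

Lemma sub_adjacent_morphism (A B : hopf_algebra C) (mA : hom (A ⊗ A) A)
  (mB : hom (B ⊗ B) B) (f : hom A B) : cocommutative A ->
  is_hopf_morphism (hopf_str A) (hopf_str B) f -> f ∘ mA = mB ∘ (f ⊠ f) ->
  f ∘ sub_adjacent_prod mA = sub_adjacent_prod mB ∘ (f ⊠ f).
Proof.
move=> hA hf fm; apply: (hopf_point_ext2 (hopf_str A) hA) => X p q hX hp hq.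
have hfp := cmor_comp (hopf_morphism_cmor hf) hp.
rewrite -(comp_assoc f) -(comp_assoc _ (f ⊠ f)) tensm_pair.
rewrite !sub_adjacent_pair //.
rewrite (hopf_morphism_conv hf) (comp_assoc f) fm -comp_assoc.
by rewrite tensm_pair.
Qed.

Lemma brace_action_morphism (A B : hopf_brace C) (f : hom A B) :
  cocommutative A -> is_hopf_brace_morphism f ->
  f ∘ brace_action (hbr1 A) (hbr2 A)
  = brace_action (hbr1 B) (hbr2 B) ∘ (f ⊠ f).
Proof.
move=> hA [f1 f2]; apply: (hopf_point_ext2 (hbr1 A) hA) => X p q hX hp hq.
have hfp := cmor_comp (hopf_morphism_cmor f1) hp.
rewrite -(comp_assoc f) -(comp_assoc _ (f ⊠ f)) tensm_pair.
rewrite !brace_action_pair //.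
rewrite (hopf_morphism_conv f1) (hopf_morphism_conv f2) !comp_assoc.
by rewrite (hopf_morphism_antipode f1).
Qed.

Lemma triple_morphism_of_brace (A B : hopf_brace C) (hA : cocommutative A)
  (hB : cocommutative B) (f : hom A B) : is_hopf_brace_morphism f ->
  @is_brace_triple_morphism C (triple_of_brace hA) (triple_of_brace hB) f.
Proof.
by move=> hf; split; [case: hf|apply: brace_action_morphism hf].
Qed.

Lemma post_hopf_morphism_of_brace (A B : hopf_brace C) (hA : cocommutative A)
  (hB : cocommutative B) (finA : finite_ob A) (finB : finite_ob B)
  (f : hom A B) : is_hopf_brace_morphism f ->
  @is_post_hopf_morphism C (post_hopf_of_brace hA finA)
    (post_hopf_of_brace hB finB) f.
Proof.
by move=> hf; split; [case: hf|apply: brace_action_morphism hf].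
Qed.

Lemma brace_morphism_of_triple (A B : brace_triple C) (hA : cocommutative A)
  (hB : cocommutative B) (f : hom A B) : is_brace_triple_morphism f ->
  @is_hopf_brace_morphism C (brace_of_triple hA) (brace_of_triple hB) f.
Proof.
move=> [hf fm]; split=> //; have [[f1 f2] f3] := hf.
by split=> //; split=> //; apply: sub_adjacent_morphism.
Qed.

Lemma brace_morphism_of_post_hopf (A B : post_hopf_algebra C)
  (hA : cocommutative A) (hB : cocommutative B) (sA : posthopf_star A)
  (sB : posthopf_star B) (f : hom A B) : is_post_hopf_morphism f ->
  @is_hopf_brace_morphism C (brace_of_post_hopf hA sA)
    (brace_of_post_hopf hB sB) f.
Proof.
move=> [hf fm]; split=> //; have [[f1 f2] f3] := hf.
by split=> //; split=> //; apply: sub_adjacent_morphism.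
Qed.

Lemma triple_brace_isomorphic : isomorphic_categories (cocBT_f C) (cocHBr_f C).
Proof.
refine (@structured_isomorphic C (brace_triple C) (hopf_brace C)
  (fun X => X) (fun X => X) (@is_brace_triple_morphism C)
  (@is_hopf_brace_morphism C) _ _ _ _
  (fun H : brace_triple C => finite_ob H /\ cocommutative H)
  (fun H : hopf_brace C => finite_ob H /\ cocommutative H)
  (fun X q => brace_of_triple (proj2 q)) (fun X q => q)
  (fun X q => triple_of_brace (proj2 q)) (fun X q => q)
  (fun _ _ => eq_refl) (fun _ _ => eq_refl) _ _ _ _).
- move=> X Y q r f hf; rewrite transport_refl.
  exact: brace_morphism_of_triple.
- move=> X Y q r f hf; rewrite transport_refl.
  exact: triple_morphism_of_brace.
- by move=> X q q'; apply: triple_of_brace_of_triple.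
- by move=> X q q'; apply: brace_of_triple_of_brace.
Qed.

Lemma brace_post_hopf_isomorphic :
  isomorphic_categories (cocHBr_f C) (cocPostHopf_star C).
Proof.
refine (@structured_isomorphic C (hopf_brace C) (post_hopf_algebra C)
  (fun X => X) (fun X => X) (@is_hopf_brace_morphism C)
  (@is_post_hopf_morphism C) _ _ _ _
  (fun H : hopf_brace C => finite_ob H /\ cocommutative H)
  (fun H : post_hopf_algebra C => cocommutative H /\ posthopf_star H)
  (fun X q => post_hopf_of_brace (proj2 q) (proj1 q))
  (fun X q => conj (proj2 q)
     (@post_hopf_of_brace_star C X (proj2 q) (proj1 q)))
  (fun X q => brace_of_post_hopf (proj1 q) (proj2 q))
  (fun X q => conj (posthopf_finite X) (proj1 q))
  (fun _ _ => eq_refl) (fun _ _ => eq_refl) _ _ _ _).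
- move=> X Y q r f hf; rewrite transport_refl.
  exact: post_hopf_morphism_of_brace.
- move=> X Y q r f hf; rewrite transport_refl.
  exact: brace_morphism_of_post_hopf.
- by move=> X q q'; apply: brace_of_post_hopf_of_brace.
- by move=> X q q'; apply: post_hopf_of_brace_of_post_hopf.
Qed.

End Morphisms.

Theorem corollary3p17 (C : strict_braided_category) :
  isomorphic_categories (cocBT_f C) (cocHBr_f C) /\
  isomorphic_categories (cocHBr_f C) (cocPostHopf_star C) /\
  isomorphic_categories (cocBT_f C) (cocPostHopf_star C).
Proof.
have h1 := triple_brace_isomorphic C; have h2 := brace_post_hopf_isomorphic C.
by split=> //; split=> //; apply: isomorphic_categories_trans h1 h2.
Qed.
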